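(* Let $(\mathbb{X},d)$ be a complete separable metric space equipped with a doubling measure $\nu$ such that $(\mathbb{X},d,\nu)$ supports a weak $(1,1)$-Poincaré inequality. Let $p\in[1,\infty)$, $\frac1p+\frac1q=1$, and suppose that $X\in L^\infty(T\mathbb{X})$ with $\mathrm{div}(X)\in L^p(\mathbb{X},\nu)$ (i.e. $X\in\mathcal{D}^{\infty,p}(\mathbb{X})$) and $u\in BV(\mathbb{X},d,\nu)\cap L^q(\mathbb{X},\nu)$. Then $$\int_{\mathbb{X}}u\,\mathrm{div}(X)\,d\nu+\int_{\mathbb{X}}(X,Du)=0 .$$
   Context: $\nu$ is a nonnegative Radon measure; doubling means there is $C_d\ge1$ with $0<\nu(B(x,2r))\le C_d\,\nu(B(x,r))<\infty$ for all $x\in\mathbb{X}$, $r>0$. A Borel $g\ge0$ is an upper gradient of $u$ if $|u(\gamma(l_\gamma))-u(\gamma(0))|\le\int_\gamma g$ for all (rectifiable) curves $\gamma:[0,l_\gamma]\to\mathbb{X}$, and a $1$-weak upper gradient if this holds for all curves outside a family of zero $1$-modulus. A weak $(1,1)$-Poincaré inequality means: there are $C_P>0$, $\lambda\ge1$ such that for every ball $B$ of radius $r$, all measurable (locally integrable) $f$ and all upper gradients $g$ of $f$, $\frac1{\nu(B)}\int_B|f-f_B|\,d\nu\le C_P\,r\,\frac1{\nu(\lambda B)}\int_{\lambda B}g\,d\nu$, where $f_B=\frac1{\nu(B)}\int_Bf\,d\nu$. $D^{1,1}(\mathbb{X})$ is the class of Borel functions having an upper gradient (equivalently a $1$-weak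 upper gradient) in $L^1(\mathbb{X},\nu)$; $W^{1,1}(\mathbb{X},d,\nu)=D^{1,1}(\mathbb{X})\cap L^1(\mathbb{X},\nu)$; $|Du|$ is the minimal $1$-weak upper gradient. Total variation: for $u\in L^1(\mathbb{X},\nu)$ and open $\Omega$, $|Du|_\nu(\Omega)=\inf\{\liminf_n\int_\Omega g_{u_n}\,d\nu:\ u_n\in \mathrm{Lip}_{loc}(\Omega),\ u_n\to u\text{ in }L^1(\Omega,\nu)\}$, with $g_{u_n}$ a $1$-weak upper gradient of $u_n$; for Borel $A$, $|Du|_\nu(A)=\inf\{|Du|_\nu(\Omega):\Omega\supset A\text{ open}\}$. $BV(\mathbb{X},d,\nu)=\{u\in L^1(\mathbb{X},\nu):|Du|_\nu(\mathbb{X})<\infty\}$, and for such $u$, $|Du|_\nu$ is a finite Borel measure. Differential structure (Gigli, exponents $1,\infty$): consider countable families $\{(f_i,A_i)\}$ with $(A_i)$ a Borel partition of $\mathbb{X}$, $f_i\in D^{1,1}(\mathbb{X})$, $\sum_i\int_{A_i}|Df_i|\,d\nu<\infty$, identifying $\{(f_i,A_i)\}$ with $\{(g_j,B_j)\}$ if $|D(f_i-g_j)|=0$ $\nu$-a.e. on $A_i\cap B_j$ for all $i,j$. Put $|\{(f_i,A_i)\}|_*:=|Df_i|$ on $A_i$. $L^1(T^*\mathbb{X})$ is the completion in the norm $\int_{\mathbb{X}}|\omega|_*\,d\nu$, with its natural $L^\infty(\mathbb{X},\nu)$-module structure; $df:=(f,\mathbb{X})$. $L^\infty(T\mathbb{X}):=\mathrm{HOM}(L^1(T^*\mathbb{X}),L^1(\mathbb{X},\nu))$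 (bounded $L^\infty$-linear maps), with action $\omega(X)$, dual pointwise norm $|X|\in L^\infty(\mathbb{X},\nu)$ and $\|X\|_\infty=\||X|\|_{L^\infty(\mathbb{X},\nu)}$. $\mathcal{D}^{\infty,p}(\mathbb{X})$ is the set of $X\in L^\infty(T\mathbb{X})$ for which there is $f\in L^p(\mathbb{X},\nu)$ with $\int fg\,d\nu=-\int dg(X)\,d\nu$ for all $g\in W^{1,1}(\mathbb{X},d,\nu)\cap L^q(\mathbb{X},\nu)$; then $\mathrm{div}(X):=f$. For $f$ Lipschitz with compact support, $fX\in\mathcal{D}^{\infty,p}(\mathbb{X})$ and $\mathrm{div}(fX)=df(X)+f\,\mathrm{div}(X)$. Anzellotti pairing: for such $X$, $u$ and $f\in\mathrm{Lip}(\mathbb{X})$ with compact support, $\langle(X,Du),f\rangle:=-\int_{\mathbb{X}}u\,\mathrm{div}(fX)\,d\nu=-\int_{\mathbb{X}}u\,df(X)\,d\nu-\int_{\mathbb{X}}u f\,\mathrm{div}(X)\,d\nu$. This functional is represented by a finite signed Radon measure, also denoted $(X,Du)$. *)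

(* Defs.v *)
From HB Require Import structures.
From mathcomp Require Import all_boot all_order all_algebra.
From mathcomp Require Import all_classical all_reals all_analysis.
From mathcomp Require Import measurable_realfun.

Set Implicit Arguments.
Unset Strict Implicit.
Unset Printing Implicit Defensive.

Import Order.TTheory GRing.Theory Num.Theory.
Import numFieldNormedType.Exports.

Local Open Scope classical_set_scope.
Local Open Scope ring_scope.

(* Elements of L^p and L^1(T^*X) are handled through representatives, with
   explicit equalities nu-almost everywhere. *)

#[short(type="completeMetricType")]
HB.structure Definition CompleteMetric (K : numDomainType) :=
  {T of Metric K T & CompletePseudoMetric K T}.

Notation borel X := (g_sigma_algebraType (@open X)).

Section MetricMeasureSpace.
Context {R : realType} {X : completeMetricType R}.
Implicit Types (nu : {measure set (borel X) -> \bar R}) (O : set X).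
Implicit Types (u f : X -> R) (g rho : X -> \bar R).

Definition separable_space (T : topologicalType) : Prop :=
  exists2 S : set T, countable S & dense S.

Definition lipschitz_on_set O u : Prop :=
  exists L : R, forall x y, O x -> O y -> `|u x - u y| <= L * mdist x y.

Definition locally_lipschitz_on O u : Prop :=
  forall x, O x -> exists2 r : R, 0 < r & lipschitz_on_set (ball x r `&` O) u.

Definition compactly_supported f : Prop :=
  compact (closure [set x | f x != 0]).

Definition radon nu : Prop :=
  (forall x : X, exists2 r : R, 0 < r & (nu (ball x r) < +oo)%E) /\
  (forall A : set (borel X), measurable A ->
     nu A = ereal_sup [set nu K | K in [set K : set X | compact K /\ K `<=` A]]).

Definition doubling nu : Prop :=
  exists2 C : R, 1 <= C & forall (x : X) (r : R), 0 < r ->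
    [/\ (0 < nu (ball x (2 * r)))%E,
        (nu (ball x (2 * r)) <= C%:E * nu (ball x r))%E
      & (C%:E * nu (ball x r) < +oo)%E].

Definition curve_length (gamma : R -> X) (a b : R) : \bar R :=
  ereal_sup [set (\sum_(0 <= k < size s)
      mdist (gamma (nth b (a :: s) k)) (gamma (nth b (a :: s) k.+1)))%:E
    | s in itv_partition a b].

(* Rectifiable curves [0, l] -> X parametrized by arc length; the values of
   the underlying total function outside of [0, l] are irrelevant. *)
Record curve := Curve {
  curve_fun :> R -> X ;
  clen : R ;
  clen_ge0 : 0 <= clen ;
  curve_arc_length : forall s t, 0 <= s -> s <= t -> t <= clen ->
    curve_length curve_fun s t = (t - s)%:E }.

Definition curve_in O (c : curve) : Prop :=
  forall t, 0 <= t -> t <= clen c -> O (c t).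

Definition line_integral (c : curve) g : \bar R :=
  (\int[lebesgue_measure]_(t in `[0%R, clen c]) g (c t))%E.

Definition upper_gradient_along u g (c : curve) : Prop :=
  (`|u (c (clen c)) - u (c 0%R)|%:E <= line_integral c g)%E.

Definition nonneg_borel_on O g : Prop :=
  measurable_fun (O : set (borel X)) g /\ (forall x, O x -> 0 <= g x)%E.

Definition admissible (G : set curve) rho : Prop :=
  nonneg_borel_on setT rho /\ forall c, G c -> (1 <= line_integral c rho)%E.

Definition modulus1 nu (G : set curve) : \bar R :=
  ereal_inf ((fun rho => \int[nu]_x rho x)%E @` admissible G).

Definition upper_gradient u g : Prop :=
  nonneg_borel_on setT g /\ forall c, upper_gradient_along u g c.

Definition weak_upper_gradient nu O u g : Prop :=
  nonneg_borel_on O g /\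
  exists2 G : set curve, modulus1 nu G = 0%E &
    forall c, curve_in O c -> ~ G c -> upper_gradient_along u g c.

Definition D11 nu u : Prop :=
  measurable_fun [set: borel X] u /\
  exists2 g, upper_gradient u g & (\int[nu]_x g x < +oo)%E.

Definition W11 nu u : Prop := D11 nu u /\ u \in Lfun nu 1%E.

Definition minimal_weak_upper_gradient nu u g : Prop :=
  [/\ weak_upper_gradient nu setT u g, (\int[nu]_x g x < +oo)%E
    & forall h, weak_upper_gradient nu setT u h -> (\int[nu]_x h x < +oo)%E ->
        {ae nu, forall x, (g x <= h x)%E}].

(* |Du|, defined up to nu-null sets. *)
Definition Dnorm nu u : X -> \bar R :=
  xget (cst 0%E) (minimal_weak_upper_gradient nu u).

Definition mean nu (A : set X) g : \bar R :=
  ((fine (nu A))^-1%:E * \int[nu]_(x in A) g x)%E.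

Definition locally_integrable_fun nu f : Prop :=
  forall x, exists2 r : R, 0 < r &
    nu.-integrable (ball x r : set (borel X)) (EFin \o f).

Definition weak_poincare11 nu : Prop :=
  exists C lambda : R, [/\ 0 < C, 1 <= lambda &
    forall (x : X) (r : R) f g, 0 < r ->
      measurable_fun [set: borel X] f -> locally_integrable_fun nu f ->
      upper_gradient f g ->
      (mean nu (ball x r)
         (fun y => `|f y - fine (mean nu (ball x r) (EFin \o f))|%:E)
       <= (C * r)%:E * mean nu (ball x (lambda * r)) g)%E].

Definition total_variation_on nu u O : \bar R :=
  ereal_inf [set v | exists (w : nat -> X -> R) (g : nat -> X -> \bar R),
    [/\ forall n, locally_lipschitz_on O (w n),
        forall n, weak_upper_gradient nu O (w n) (g n),
        (fun n => \int[nu]_(x in O) `|w n x - u x|%:E)%E @ \oo --> 0%E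
      & v = limn_einf (fun n => \int[nu]_(x in O) g n x)%E]].

Definition BV nu u : Prop :=
  u \in Lfun nu 1%E /\ (total_variation_on nu u setT < +oo)%E.

(* Families {(f_i, A_i)} with loc i = f_i and piece i = A_i. *)
Record form_family := FormFamily {
  idx : countType ;
  loc : idx -> X -> R ;
  piece : idx -> set X }.

Definition family_add (F G : form_family) : form_family :=
  @FormFamily (idx F * idx G)%type
    (fun ij x => loc ij.1 x + loc ij.2 x)
    (fun ij => piece ij.1 `&` piece ij.2).

Definition family_sub (F G : form_family) : form_family :=
  @FormFamily (idx F * idx G)%type
    (fun ij x => loc ij.1 x - loc ij.2 x)
    (fun ij => piece ij.1 `&` piece ij.2).

(* The product of F with the function 2^-n * floor (2^n * h), which takes
   countably many values. *)
Definition family_scale (n : nat) (h : X -> R) (F : form_family) : form_family :=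
  @FormFamily (idx F * int)%type
    (fun ij x => ij.2%:~R / 2 ^+ n * loc ij.1 x)
    (fun ij => piece ij.1 `&` [set x | Num.floor (2 ^+ n * h x) = ij.2]).

Definition precotangent nu (F : form_family) : Prop :=
  [/\ forall i : idx F, D11 nu (loc i),
      forall i : idx F, measurable (piece i : set (borel X)),
      trivIset setT (@piece F) /\ \bigcup_i @piece F i = setT
    & (\esum_(i in [set: idx F]) \int[nu]_(x in piece i) Dnorm nu (loc i) x
         < +oo)%E].

(* |{(f_i, A_i)}|_*; on a partition the sum has a single term. *)
Definition family_pnorm nu (F : form_family) (x : X) : \bar R :=
  (\esum_(i in [set i : idx F | piece i x]) Dnorm nu (loc i) x)%E.

Definition family_norm nu (F : form_family) : \bar R :=
  (\int[nu]_x family_pnorm nu F x)%E.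

(* L^1(T^*X) is the completion: Cauchy sequences of families for the norm
   above, modulo sequences at distance tending to zero.  Constant sequences F
   and G are thus equal exactly when |D(f_i - g_j)| = 0 a.e. on A_i `&` B_j. *)
Definition oneform := nat -> form_family.

Definition L1cotangent nu (w : oneform) : Prop :=
  (forall n, precotangent nu (w n)) /\
  (forall e : R, 0 < e -> exists N : nat, forall m n : nat,
     (N <= m)%N -> (N <= n)%N ->
     (family_norm nu (family_sub (w m) (w n)) < e%:E)%E).

Definition oneform_eq nu (w z : oneform) : Prop :=
  (fun n => family_norm nu (family_sub (w n) (z n))) @ \oo --> 0%E.

Definition oneform_norm nu (w : oneform) : \bar R :=
  limn (fun n => family_norm nu (w n)).

Definition oneform_add (w z : oneform) : oneform :=
  fun n => family_add (w n) (z n).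

(* The module structure over L^oo: 2^-n * floor (2^n * h) tends to h
   uniformly. *)
Definition oneform_scale (h : X -> R) (w : oneform) : oneform :=
  fun n => family_scale n h (w n).

Definition differential f : oneform :=
  fun=> @FormFamily unit (fun=> f) (fun=> setT).

(* L^oo(TX) = HOM(L^1(T^*X), L^1(X)); V w is the action w(V), and its values
   at sequences outside of L^1(T^*X) are irrelevant. *)
Definition Linf_tangent nu (V : oneform -> X -> R) : Prop :=
  [/\ forall w, L1cotangent nu w -> V w \in Lfun nu 1%E,
      forall w z, L1cotangent nu w -> L1cotangent nu z -> oneform_eq nu w z ->
        {ae nu, forall x, V w x = V z x},
      forall w z, L1cotangent nu w -> L1cotangent nu z ->
        {ae nu, forall x, V (oneform_add w z) x = V w x + V z x},
      forall h w, h \in Lfun nu +oo%E -> L1cotangent nu w ->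
        {ae nu, forall x, V (oneform_scale h w) x = h x * V w x}
    & exists C : R, forall w, L1cotangent nu w ->
        (\int[nu]_x `|V w x|%:E <= C%:E * oneform_norm nu w)%E].

Definition field_scale (f : X -> R) (V : oneform -> X -> R) :
    oneform -> X -> R :=
  fun w x => f x * V w x.

(* V belongs to D^{oo,p}(X) and div(V) = D. *)
Definition has_divergence nu (p q : \bar R) (V : oneform -> X -> R)
    (D : X -> R) : Prop :=
  [/\ Linf_tangent nu V, D \in Lfun nu p
    & forall g : X -> R, W11 nu g -> g \in Lfun nu q ->
        (\int[nu]_x (D x * g x) = - \int[nu]_x V (differential g) x)%R].

Definition charge_integral (mu : {charge set (borel X) -> \bar R})
    (P N : set (borel X)) (h : hahn_decomposition mu P N) (f : X -> R) : R :=
  (\int[jordan_pos h]_x f x - \int[jordan_neg h]_x f x)%R.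

(* mu is the finite signed Radon measure (V, Du).  Neither div(fV), given here
   by D, nor the integral against mu depends on choices: the first is unique
   a.e., the second is the same for all Hahn decompositions. *)
Definition anzellotti_measure nu (p q : \bar R) (V : oneform -> X -> R)
    (u : X -> R) (mu : {charge set (borel X) -> \bar R}) : Prop :=
  exists (P N : set (borel X)) (h : hahn_decomposition mu P N),
    radon (charge_variation h) /\
    forall f : X -> R, lipschitz_on_set setT f -> compactly_supported f ->
    forall D : X -> R, has_divergence nu p q (field_scale f V) D ->
      (charge_integral h f = - \int[nu]_x (u x * D x))%R.

End MetricMeasureSpace.

(* Main.v *)
Require Import Defs.
From mathcomp Require Import all_boot all_order all_algebra.
From mathcomp Require Import all_classical all_reals all_analysis.
From mathcomp Require Import measurable_realfun ess_sup_inf ring lra.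

Set Implicit Arguments.
Unset Strict Implicit.
Unset Printing Implicit Defensive.

Import Order.TTheory GRing.Theory Num.Theory.
Import numFieldNormedType.Exports.

Local Open Scope classical_set_scope.
Local Open Scope ring_scope.

(** Why the formula holds.  If the constant 1 were an admissible test function,
    the identity would be the definition of the pairing with [f = 1], since
    [d1 = 0].  It is not compactly supported, so it is replaced by cutoffs
    [eta_n] with values in [0, 1], equal to 1 on the ball of radius [n + 1] and
    Lipschitz with constant [1 / (n + 1)].  They have compact support because a
    complete doubling space is proper ([closed_in_ball_compact]).  Testing the
    pairing against [eta_n] gives
      [int eta_n d(X, Du) = - int u deta_n(X) - int u eta_n div X].
    The left side tends to the total mass of [(X, Du)], as the measure is
    finite; the last integral tends to [int u div X], as [u div X] is
    integrable by Hoelder; and the middle one is at most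
    [C / (n + 1) * int |u|], as [|deta_n(X)| <= C |D eta_n|].

    The work is in the two facts on tangent fields used above: the pointwise
    bound [tangent_bound], and the formula
    [div(eta X) = deta(X) + eta div X] ([has_divergence_scale]).  The latter
    follows from the Leibniz rule [d(eta g) = eta dg + g deta]
    ([tangent_leibniz]) for bounded [g], and from truncation for general [g].
    The Leibniz rule compares elements of a completion whose scalar
    multiplication is defined by dyadic approximation: on the set where [eta]
    and [g] are within [2^-n] of dyadic constants [a] and [b], the function
    [eta g - (a g + b eta)] is [(eta - a)(g - b)] up to a constant, and the
    minimal weak upper gradient of that product is at most
    [2^-n (|D eta| + |D g|)].

    Hence everything rests on a calculus of minimal weak upper gradients:
    existence ([curvewise_minimal]), the lattice property ([curvewise_min]),
    the product rule ([curvewiseM]) and a locality property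
    ([curvewise_truncation]).  Each is a statement on almost every curve, that
    is, on a real function on an interval whose increments are bounded by
    integrals of a density ([controls]), and is proved there first. *)

(** * Splitting integrals over measurable sets *)

Lemma measurable_mem d (T : measurableType d) (E : set T) : measurable E ->
  measurable_fun [set: T] (fun x => x \in E).
Proof.
move=> mE; apply: (measurable_fun_bool true); rewrite setTI.
rewrite [X in measurable X](_ : _ = E)//.
by apply/seteqP; split => x /= => [/set_mem|/mem_set].
Qed.

Lemma ge0_integral_setUC d (T : measurableType d) (R : realType)
    (mu : {measure set T -> \bar R}) (E : set T) (f : T -> \bar R) :
  measurable E -> measurable_fun [set: T] f -> (forall x, 0 <= f x)%E ->
  (\int[mu]_x f x = \int[mu]_(x in E) f x + \int[mu]_(x in ~` E) f x)%E.
Proof.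
move=> mE mf f0; rewrite -(setUv E) ge0_integral_setU//.
- exact: measurableC.
- exact: measurable_funTS.
- by rewrite disj_set2E setICr.
Qed.

(** * Functions on an interval controlled by a density *)

Section DensityOnInterval.
Context {R : realType}.
Local Notation mu := (@lebesgue_measure R).
Implicit Types (l s t r x : R) (phi psi : R -> R) (a b c : R -> \bar R).

Definition density l a : Prop :=
  [/\ measurable_fun [set: R] a, forall x, (0 <= a x)%E
    & (\int[mu]_(x in `]0%R, l]) a x < +oo)%E].

(** On [`[0, l]] this says that [phi] is absolutely continuous with
    [|phi'| <= a] almost everywhere. *)
Definition controls l phi a : Prop := forall s t, 0 <= s -> s <= t -> t <= l ->
  (`|phi t - phi s|%:E <= \int[mu]_(x in `]s, t]) a x)%E.

Lemma density_split l a s r t : density l a -> s <= r -> r <= t ->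
  (\int[mu]_(x in `]s, t]) a x =
   \int[mu]_(x in `]s, r]) a x + \int[mu]_(x in `]r, t]) a x)%E.
Proof.
move=> [ma a0 _] sr rt.
rewrite (@itv_bndbnd_setU _ _ _ (BRight r)) ?bnd_simp//.
rewrite ge0_integral_setU//=; first exact: measurable_funTS.
apply/disj_setPS => x [/=]; rewrite !in_itv/= => /andP[_ xr] /andP[rx _].
by move: (lt_le_trans rx xr); rewrite ltxx.
Qed.

Lemma density_mono l a s t s' t' : density l a -> s' <= s -> t <= t' ->
  (\int[mu]_(x in `]s, t]) a x <= \int[mu]_(x in `]s', t']) a x)%E.
Proof.
move=> [ma a0 _] ss tt; apply: ge0_subset_integral => //.
  exact: measurable_funTS.
by apply: subset_itv; rewrite bnd_simp.
Qed.

Lemma density_fin l a s t : density l a -> 0 <= s -> t <= l ->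
  (\int[mu]_(x in `]s, t]) a x < +oo)%E.
Proof.
by move=> da s0 tl; case: (da) => _ _; apply/le_lt_trans/(density_mono da).
Qed.

Lemma density_patch l a b (E : set R) : density l a -> density l b ->
  measurable E -> density l (fun x => if x \in E then a x else b x).
Proof.
move=> [ma a0 ia] [mb b0 ib] mE.
have mp : measurable_fun [set: R] (fun x => if x \in E then a x else b x).
  by apply: measurable_fun_ifT => //; exact: measurable_mem.
split => //; first by move=> x; case: ifP.
apply: (@le_lt_trans _ _ (\int[mu]_(x in `]0%R, l]) (a x + b x))%E).
  apply: ge0_le_integral => //; first by move=> x _; case: ifP.
  - exact: measurable_funTS.
  - by apply: measurable_funTS; exact: emeasurable_funD.
  - by move=> x _; case: ifP => _; [rewrite leeDl|rewrite leeDr].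
rewrite ge0_integralD//; [exact: lte_add_pinfty| |]; exact: measurable_funTS.
Qed.

(** The supremum of the times up to which the bound holds from [s] can always be
    exceeded, by adding a bound valid near it. *)
Lemma controls_local l phi c : density l c ->
  (forall x, 0 <= x <= l -> exists2 d : R, 0 < d & forall s t,
     0 <= s -> s <= t -> t <= l -> `|s - x| < d -> `|t - x| < d ->
     (`|phi t - phi s|%:E <= \int[mu]_(x in `]s, t]) c x)%E) ->
  controls l phi c.
Proof.
move=> dc loc s t s0 st tl.
pose S : set R := [set r | s <= r <= t /\
  (`|phi r - phi s|%:E <= \int[mu]_(x in `]s, r]) c x)%E].
have Ss : S s.
  by split; rewrite ?lexx ?st// subrr normr0 integral_ge0//; case: dc.
have Sub : ubound S t by move=> r [/andP[]].
have hS : has_sup S by split; [exists s|exists t].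
have sx : s <= sup S by apply: ub_le_sup => //; exists t.
have xt : sup S <= t by apply: ge_sup => //; exists s.
set x := sup S in sx xt *.
have [|d d0 H] := loc x; first by rewrite (le_trans s0 sx) (le_trans xt tl).
have [r [/andP[sr rt] Sr] xdr] := sup_adherent d0 hS.
rewrite -/x in xdr.
have rx : r <= x by apply: ub_le_sup; [exists t|split => //; rewrite sr].
pose y := Num.min t (x + d / 2).
have yt : y <= t by rewrite /y ge_min lexx.
have xy : x <= y by rewrite le_min xt lerDl divr_ge0// ltW.
have Sy : S y.
  split; first by rewrite yt (le_trans sx).
  rewrite (density_split dc sr (le_trans rx xy)).
  have -> : phi y - phi s = (phi r - phi s) + (phi y - phi r) by ring.
  apply: (@le_trans _ _ (`|phi r - phi s| + `|phi y - phi r|)%:E).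
    by rewrite lee_fin ler_normD.
  rewrite EFinD leeD//; apply: H => //.
  - exact: le_trans sr.
  - exact: le_trans xy.
  - exact: le_trans tl.
  - by rewrite ltr_distl; apply/andP; split => //; rewrite (le_lt_trans rx)// ltrDl.
  - rewrite ltr_distl; apply/andP; split; first by rewrite (lt_le_trans _ xy)// ltrBlDr ltrDl.
    by rewrite /y gt_min ltrD2l; apply/orP; right; lra.
have yx : y <= x by apply: ub_le_sup => //; exists t.
suff ty : t = y by rewrite ty; case: Sy.
move: yx; rewrite {1}/y ge_min => /orP[tx|].
  by apply/eqP; rewrite eq_le yt andbT (le_trans tx).
by rewrite gerDl leNgt divr_gt0.
Qed.

(** Absolute continuity of the integral, applied to [fine \o a], which agrees
    with [a] almost everywhere. *)
Lemma density_small l a x (e : R) : density l a -> 0 < e ->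
  exists2 d : R, 0 < d & forall s t, 0 <= s -> s <= t -> t <= l ->
    `|s - x| < d -> `|t - x| < d -> (\int[mu]_(x in `]s, t]) a x < e%:E)%E.
Proof.
move=> da e0; have [ma a0 ia] := da.
pose f := fine \o (a \_ `]0%R, l]).
have mr : measurable_fun setT (a \_ `]0%R, l]).
  by apply: (iffLR (measurable_restrictT _ _)) => //; apply: measurable_funTS.
have ira : mu.-integrable setT (a \_ `]0%R, l]).
  apply/integrable_restrict => //; rewrite setTI; apply/integrableP; split.
    exact: measurable_funTS.
  by under eq_integral do rewrite gee0_abs//.
have aef : ae_eq mu setT (EFin \o f) (a \_ `]0%R, l]).
  have := integrable_ae measurableT ira.
  by apply: filterS => x0 h _; rewrite /f/= fineK//; exact: h.
have mf : measurable_fun setT (EFin \o f).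
  by apply/measurable_EFinP; apply: measurableT_comp => //; exact: fine_measurable.
have fi : mu.-integrable setT (EFin \o f).
  apply/integrableP; split => //.
  have -> : (\int[mu]_x `|(EFin \o f) x| = \int[mu]_x `|(a \_ `]0%R, l]) x|)%E.
    apply: ge0_ae_eq_integral => //; [exact: measurableT_comp|exact: measurableT_comp|].
    by apply: filterS aef => x0 h xT; congr abse; exact: h.
  by case/integrableP: ira.
have [d [d0 H]] := integral_normr_continuous fi e0.
exists (d / 2); first by rewrite divr_gt0.
move=> s t s0 st tl sx tx.
have -> : (\int[mu]_(x in `]s, t]) a x = \int[mu]_(x in `]s, t]) `|f x|%:E)%E.
  have e1 : (\int[mu]_(x in `]s, t]) a x = \int[mu]_(x in `]s, t]) (a \_ `]0%R, l]) x)%E.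
    apply: eq_integral => z; rewrite inE/= in_itv/= => /andP[sz zt].
    by rewrite patchE ifT// inE/= in_itv/= (le_lt_trans s0 sz) (le_trans zt tl).
  rewrite e1; apply: ge0_ae_eq_integral => //.
  - exact: measurable_funTS.
  - apply: measurable_funTS; apply/measurable_EFinP; apply: measurableT_comp => //.
    exact/measurable_EFinP.
  - by move=> z _; apply: erestrict_ge0.
  - apply: filterS aef => z h _; rewrite -(h Logic.I)/= ger0_norm//.
    by rewrite fine_ge0//; apply: erestrict_ge0.
have mst : (mu `]s, t]%classic < d%:E)%E.
  rewrite lebesgue_measure_itv/= lte_fin; case: ifPn => // _.
  by rewrite -EFinB lte_fin; move: sx tx; rewrite !ltr_distl; lra.
have := H _ (measurable_itv _) mst.
rewrite /Rintegral -lte_fin fineK//.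
have fi' : mu.-integrable `]s, t] (EFin \o f) by apply: integrableS fi.
by apply: integrable_fin_num => //; exact: integrable_norm fi'.
Qed.

Lemma controls_continuous l phi a x (e : R) : density l a -> controls l phi a ->
  0 <= x <= l -> 0 < e -> exists2 d : R, 0 < d & forall t, 0 <= t -> t <= l ->
    `|t - x| < d -> `|phi t - phi x| < e.
Proof.
move=> da ca /andP[x0 xl] e0; have [d d0 H] := density_small x da e0.
exists d => // t t0 tl tx; rewrite -lte_fin.
have xx : `|x - x| < d by rewrite subrr normr0.
have [xt|/ltW tx'] := leP x t.
  by apply: le_lt_trans (ca _ _ _ _ _) _ => //; exact: H.
by rewrite distrC; apply: le_lt_trans (ca _ _ _ _ _) _ => //; exact: H.
Qed.

Lemma controls_le l phi a b : density l a -> density l b ->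
  (forall x, 0 <= x <= l -> (a x <= b x)%E) -> controls l phi a -> controls l phi b.
Proof.
move=> [ma a0 _] [mb b0 _] ab ca s t s0 st tl.
apply: (le_trans (ca _ _ s0 st tl)); apply: ge0_le_integral => //.
- exact: measurable_funTS.
- exact: measurable_funTS.
- move=> x /=; rewrite in_itv/= => /andP[sx xt]; apply: ab.
  by rewrite (le_trans s0 (ltW sx)) (le_trans xt tl).
Qed.

Lemma densityD l a b : density l a -> density l b ->
  density l (fun x => a x + b x)%E.
Proof.
move=> [ma a0 ia] [mb b0 ib]; split; first exact: emeasurable_funD.
  by move=> x; rewrite adde_ge0.
by rewrite ge0_integralD//; [exact: lte_add_pinfty|exact: measurable_funTS..].
Qed.

Lemma densityZ l a (k : R) : 0 <= k -> density l a ->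
  density l (fun x => k%:E * a x)%E.
Proof.
move=> k0 [ma a0 ia]; split; first exact: measurable_funeM.
  by move=> x; rewrite mule_ge0.
rewrite ge0_integralZl_EFin//; last exact: measurable_funTS.
by rewrite lte_mul_pinfty.
Qed.

(** The sets along which any two controlling densities may be glued form a
    sigma-algebra: complements exchange the roles of [a] and [b], finite unions
    iterate the gluing, and countable unions pass to the limit by dominated
    convergence.  It contains the rays, by cutting an interval in two. *)
Lemma controls_patch l phi a b (E : set R) : measurable E ->
  density l a -> density l b -> controls l phi a -> controls l phi b ->
  controls l phi (fun x => if x \in E then a x else b x).
Proof.
move=> mE; move: a b.
pose G : set (set R) := [set E | measurable E /\ forall a b, density l a ->
  density l b -> controls l phi a -> controls l phi b ->
  controls l phi (fun x => if x \in E then a x else b x)].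
suff : G E by case.
have sG : sigma_algebra setT G.
  split.
  - split => // a b _ _ _ cb; have -> // : (fun x => if x \in set0 then a x else b x) = b.
    by apply/funext => x; rewrite in_set0.
  - move=> A [mA GA]; split; first by rewrite setTD; exact: measurableC.
    move=> a b da db ca cb.
    have -> : (fun x => if x \in setT `\` A then a x else b x) =
              (fun x => if x \in A then b x else a x).
      by apply/funext => x; rewrite setTD in_setC; case: (x \in A).
    exact: GA.
  - move=> F GF; pose U n := \big[setU/set0]_(i < n) F i.
    have mF n : measurable (F n) by case: (GF n).
    have mU n : measurable (U n) by exact: bigsetU_measurable.
    have mUF : measurable (\bigcup_k F k) by exact: bigcupT_measurable.
    split => // a b da db ca cb.
    pose c (E : set R) x := if x \in E then a x else b x.
    have dc (A : set R) : measurable A -> density l (c A) by exact: density_patch.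
    have cU n : controls l phi (c (U n)).
      elim: n => [|n IH].
        have -> // : c (U 0%N) = b.
        by apply/funext => x; rewrite /c /U big_ord0 in_set0.
      have -> : c (U n.+1) = (fun x => if x \in F n then a x else c (U n) x).
        apply/funext => x; rewrite /c /U big_ord_recr/= in_setU.
        by case: (x \in F n); rewrite ?orbT ?orbF.
      by case: (GF n) => _; apply => //; exact: dc.
    move=> s t s0 st tl.
    have dab := densityD da db; have [mab ab0 _] := dab.
    have [|||||_ _ cv] := @dominated_convergence _ _ _ mu `]s, t] (measurable_itv _)
        (fun n => c (U n)) (c (\bigcup_k F k)) (fun x => a x + b x)%E.
    + by move=> n; case: (dc _ (mU n)) => mc _ _; exact: measurable_funTS.
    + by case: (dc _ mUF) => mc _ _; exact: measurable_funTS.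
    + apply/aeW => x _; apply: cvg_near_cst.
      have [[k _ Fk]|nF] := pselect ((\bigcup_k F k) x).
        exists k.+1 => // n /= kn; rewrite /c !mem_set//; first by exists k.
        by rewrite /U -bigcup_mkord; exists k.
      exists 0%N => // n _; rewrite /c !memNset//.
      by rewrite /U -bigcup_mkord => -[k _ Fk]; apply: nF; exists k.
    + apply/integrableP; split; first exact: measurable_funTS.
      under eq_integral do rewrite gee0_abs//.
      exact: density_fin dab s0 tl.
    + have [_ a0 _] := da; have [_ b0 _] := db.
      apply/aeW => x n _; rewrite gee0_abs; last by rewrite /c; case: ifP.
      by rewrite /c; case: ifP => _; rewrite ?leeDl ?leeDr.
    apply: (closed_cvg (fun y => (`|phi t - phi s|%:E <= y)%E)) cv => //.
      exact: closed_ereal_le_ereal.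
    by apply: nearW => n /=; exact: cU.
have mE' : (@RGenOInfty.G R).-sigma.-measurable E by rewrite -RGenOInfty.measurableE.
move: E mE' {mE}; apply: smallest_sub => // _ [x ->]; split; first exact: measurable_itv.
move=> a b da db ca cb s t s0 st tl.
have dc : density l (fun y => if y \in `]x, +oo[%classic then a y else b y).
  exact: density_patch.
have e1 y z : x <= y -> (\int[mu]_(w in `]y, z])
    (if w \in `]x, +oo[%classic then a w else b w) = \int[mu]_(w in `]y, z]) a w)%E.
  move=> xy; apply: eq_integral => w; rewrite inE/= in_itv/= => /andP[yw _].
  by rewrite mem_set//= in_itv/= andbT (le_lt_trans xy).
have e2 y z : z <= x -> (\int[mu]_(w in `]y, z])
    (if w \in `]x, +oo[%classic then a w else b w) = \int[mu]_(w in `]y, z]) b w)%E.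
  move=> zx; apply: eq_integral => w; rewrite inE/= in_itv/= => /andP[_ wz].
  by rewrite memNset//= in_itv/= andbT; apply/negP; rewrite -leNgt (le_trans wz).
have [tx|/ltW xt] := leP t x; first by rewrite e2//; exact: cb.
have [xs|/ltW sx] := leP x s; first by rewrite e1//; exact: ca.
rewrite (density_split dc sx xt) (e1 x t)// (e2 s x)//.
have -> : phi t - phi s = (phi x - phi s) + (phi t - phi x) by ring.
apply: (@le_trans _ _ (`|phi x - phi s| + `|phi t - phi x|)%:E).
  by rewrite lee_fin ler_normD.
rewrite EFinD leeD//; [apply: cb|apply: ca] => //; exact: le_trans sx || exact: le_trans tl.
Qed.

(** Glue along the set where [a < b]. *)
Lemma controls_min l phi a b : density l a -> density l b ->
  controls l phi a -> controls l phi b ->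
  controls l phi (fun x => Order.min (a x) (b x)).
Proof.
move=> da db ca cb; have [ma _ _] := da; have [mb _ _] := db.
have mE : measurable [set x | (a x < b x)%E].
  by rewrite -[X in measurable X]setTI; exact: emeasurable_fun_lt.
have := controls_patch mE da db ca cb.
congr controls; apply/funext => x; rewrite minEle.
case: (boolP (a x < b x)%E) => ab; first by rewrite mem_set// ltW.
by rewrite memNset; [move: ab; case: ltgtP|apply/negP].
Qed.

Lemma controls_eps l phi a b : density l a -> density l b ->
  (forall e : R, 0 < e -> controls l phi (fun x => a x + e%:E * b x)%E) ->
  controls l phi a.
Proof.
move=> da db H s t s0 st tl; have [ma a0 _] := da; have [mb b0 _] := db.
have bfin := density_fin db s0 tl.
have b0' : (0 <= \int[mu]_(x in `]s, t]) b x)%E by apply: integral_ge0.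
apply/lee_addgt0Pr => e e0.
pose K := fine (\int[mu]_(x in `]s, t]) b x) + 1.
have K0 : 0 < K by rewrite ltr_wpDl// fine_ge0.
have := H (e / K) (divr_gt0 e0 K0) s t s0 st tl.
move=> /le_trans; apply.
rewrite ge0_integralD//; last 3 first.
- exact: measurable_funTS.
- by move=> x _; rewrite mule_ge0// lee_fin divr_ge0// ltW.
- by apply: measurable_funTS; exact: measurable_funeM.
rewrite leeD2l// ge0_integralZl_EFin//; last 2 first.
- exact: measurable_funTS.
- by rewrite divr_ge0// ltW.
rewrite -(@fineK _ (\int[mu]_(x in `]s, t]) b x)%E) ?ge0_fin_numE//.
rewrite -EFinM lee_fin mulrAC ler_pdivrMr// ler_wpM2l ?(ltW e0)//.
by rewrite /K lerDl.
Qed.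

(** Near any time both factors are within [e / 2] of their values there, by
    continuity, so the product rule holds there up to [e (a + b)]. *)
Lemma controlsM l phi psi a b : density l a -> density l b ->
  density l (fun x => `|phi x|%:E * b x + `|psi x|%:E * a x)%E ->
  controls l phi a -> controls l psi b ->
  controls l (fun x => phi x * psi x)
    (fun x => `|phi x|%:E * b x + `|psi x|%:E * a x)%E.
Proof.
move=> da db dab ca cb; have [ma a0 _] := da; have [mb b0 _] := db.
have dba := densityD da db.
apply: (controls_eps dab dba) => e e0.
have dc := densityD dab (densityZ (ltW e0) dba).
apply: controls_local => // x xl.
have e20 : 0 < e / 2 by rewrite divr_gt0.
have [d1 d10 H1] := controls_continuous da ca xl e20.
have [d2 d20 H2] := controls_continuous db cb xl e20.
exists (Num.min d1 d2); first by rewrite lt_min d10.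
move=> s t s0 st tl; rewrite !lt_min => /andP[s1 s2] /andP[t1 t2].
have -> : phi t * psi t - phi s * psi s =
  phi t * (psi t - psi s) + psi s * (phi t - phi s) by ring.
apply: (@le_trans _ _ (`|phi t| * `|psi t - psi s| + `|psi s| * `|phi t - phi s|)%:E).
  by rewrite lee_fin (le_trans (ler_normD _ _))// !normrM.
rewrite EFinD !EFinM.
apply: (@le_trans _ _ (`|phi t|%:E * \int[mu]_(y in `]s, t]) b y +
                       `|psi s|%:E * \int[mu]_(y in `]s, t]) a y)%E).
  by rewrite leeD// lee_wpmul2l//; [exact: cb|exact: ca].
have ms (g : R -> \bar R) : measurable_fun setT g -> measurable_fun `]s, t] g.
  exact: measurable_funTS.
rewrite -!ge0_integralZl_EFin//; [|exact: ms..].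
rewrite -ge0_integralD//; last 4 first.
- by move=> y _; rewrite mule_ge0.
- by apply: ms; exact: measurable_funeM.
- by move=> y _; rewrite mule_ge0.
- by apply: ms; exact: measurable_funeM.
have [mc c0 _] := dc.
apply: ge0_le_integral => //.
- by move=> y _; rewrite adde_ge0// mule_ge0.
- by apply: ms; apply: emeasurable_funD; exact: measurable_funeM.
- exact: ms.
move=> y /=; rewrite in_itv/= => /andP[sy yt].
have y0 : 0 <= y := le_trans s0 (ltW sy).
have yl : y <= l := le_trans yt tl.
have yd : `|y - x| < Num.min d1 d2.
  rewrite lt_min; move: s1 s2 t1 t2; rewrite !ltr_distl.
  move=> /andP[? ?] /andP[? ?] /andP[? ?] /andP[? ?].
  by apply/andP; split; apply/andP; split; lra.
move: yd; rewrite lt_min => /andP[y1 y2].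
have close (f : R -> R) (z : R) : `|z| = `|z| -> `|f y - f x| < e / 2 -> `|f z - f x| < e / 2 ->
    `|f z| <= `|f y| + e.
  move=> _ fy fz; have -> : f z = f y + ((f z - f x) - (f y - f x)) by ring.
  rewrite (le_trans (ler_normD _ _))// lerD2l (le_trans (ler_normB _ _))//.
  by rewrite ltW// [ltRHS](splitr e) ltrD.
have tp : `|phi t| <= `|phi y| + e.
  by apply: close => //; apply: H1 => //; exact: le_trans st.
have sp : `|psi s| <= `|psi y| + e.
  by apply: close => //; apply: H2 => //; exact: le_trans tl.
apply: (@le_trans _ _ ((`|phi y| + e)%:E * b y + (`|psi y| + e)%:E * a y)%E).
  by rewrite leeD// lee_wpmul2r// lee_fin.
rewrite !EFinD !ge0_muleDl ?lee_fin ?(ltW e0)// ge0_muleDr//.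
by rewrite addeACA [X in (_ + X)%E]addeC.
Qed.

(** A density is useless near the times where [phi] is locally constant: it may
    be set to 0 outside of any [U] containing a neighbourhood of each remaining
    time.  This yields the locality of gradients. *)
Lemma controls_restrict l phi a (U : set R) : density l a -> controls l phi a ->
  density l (fun x => if x \in U then a x else 0%E) ->
  (forall x, 0 <= x <= l -> exists2 d : R, 0 < d &
     (forall y, 0 <= y <= l -> `|y - x| < d -> U y) \/
     (forall y, 0 <= y <= l -> `|y - x| < d -> phi y = phi x)) ->
  controls l phi (fun x => if x \in U then a x else 0%E).
Proof.
move=> da ca dU H; apply: controls_local => // x xl.
have [d d0 Hd] := H x xl; exists d => // s t s0 st tl sx tx.
have sl := le_trans st tl; have t0 := le_trans s0 st.
case: Hd => [Ud|cd]; last first.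
  rewrite !cd ?s0 ?sl ?t0 ?tl// subrr normr0; apply: integral_ge0 => y _.
  by case: dU.
apply: (le_trans (ca _ _ s0 st tl)).
rewrite le_eqVlt; apply/orP; left; apply/eqP; apply: eq_integral => y.
rewrite inE/= in_itv/= => /andP[sy yt]; rewrite mem_set//; apply: Ud.
  by rewrite (le_trans s0 (ltW sy)) (le_trans yt tl).
move: sx tx; rewrite !ltr_distl => /andP[? ?] /andP[? ?].
by apply/andP; split; lra.
Qed.

Lemma controls_cvg l phi (a_ : nat -> R -> \bar R) a b : density l b ->
  (forall n, density l (a_ n)) -> (forall n, controls l phi (a_ n)) ->
  (forall n x, a_ n x <= b x)%E -> measurable_fun setT a ->
  (forall x, a_ ^~ x @ \oo --> a x) -> controls l phi a.
Proof.
move=> db da ca ab ma cva s t s0 st tl; have [mb b0 _] := db.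
have [|||||_ _ cv] := @dominated_convergence _ _ _ mu `]s, t] (measurable_itv _)
    a_ a b.
- by move=> n; case: (da n) => ? _ _; exact: measurable_funTS.
- exact: measurable_funTS.
- by apply/aeW => x _.
- apply/integrableP; split; first exact: measurable_funTS.
  under eq_integral do rewrite gee0_abs//.
  exact: density_fin db s0 tl.
- by apply/aeW => x n _; rewrite gee0_abs//; case: (da n).
apply: (closed_cvg (fun y => (`|phi t - phi s|%:E <= y)%E)) cv => //.
  exact: closed_ereal_le_ereal.
by apply: nearW => n /=; exact: ca.
Qed.

End DensityOnInterval.

(** * Curves *)

(** By uniqueness of Lebesgue measure on half-open intervals. *)
Lemma ge0_integral_shift {R : realType} (v s t : R) (f : R -> \bar R) :
  measurable_fun [set: R] f -> (forall r, 0 <= f r)%E ->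
  (\int[lebesgue_measure]_(x in `[s, t]) f (v + x)%R =
   \int[lebesgue_measure]_(x in `[(v + s)%R, (v + t)%R]) f x)%E.
Proof.
move=> mf f0.
pose h : R -> measurableTypeR R := fun x => v + x.
have mh : measurable_fun [set: measurableTypeR R] h by exact: measurable_funD.
have hE : h @^-1` `[v + s, v + t]%classic = `[s, t]%classic.
  by apply/seteqP; split => x; rewrite /h /= !in_itv/= !lerD2l.
have : (\int[pushforward lebesgue_measure h]_(x in `[(v + s)%R, (v + t)%R]) f x =
  \int[lebesgue_measure]_(x in h @^-1` `[(v + s)%R, (v + t)%R]%classic) f (h x))%E.
  by rewrite ge0_integral_pushforward//=; exact: measurable_funTS.
rewrite hE => <-; apply: eq_measure_integral => A mA _; apply/esym.
apply: lebesgue_measure_unique => // _ [[a b] _ <-] /=.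
rewrite /pushforward.
have -> : h @^-1` `]a, b]%classic = `]a - v, b - v]%classic.
  by apply/seteqP; split => x; rewrite /h /= !in_itv/= ltrBlDl lerBrDl.
rewrite !lebesgue_measure_itv/= !lte_fin ltrD2r.
by case: ifPn => // _; rewrite -!EFinB; congr _%:E; ring.
Qed.

Section Curves.
Context {R : realType} {X : completeMetricType R}.
Implicit Types (c : @curve R X) (g : X -> \bar R) (u v w : X -> R).
Local Notation mu := (@lebesgue_measure R).

(** A curve is a total function with unspecified values outside of its interval
    of definition; cutting off makes [along c g] Borel on the whole line. *)
Definition along c g : R -> \bar R := (g \o c) \_ `[0, clen c].

Lemma curve_length_ge (gamma : R -> X) a b : a <= b ->
  ((mdist (gamma a) (gamma b))%:E <= curve_length gamma a b)%E.
Proof.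
rewrite le_eqVlt => /predU1P[<-|ab].
  rewrite mdistxx; apply: ereal_sup_ubound; exists [::] => /=.
    by rewrite /itv_partition/=.
  by rewrite big_geq.
apply: ereal_sup_ubound; exists [:: b] => /=; first exact: itv_partition1.
by rewrite big_nat1.
Qed.

Lemma curve_lip c s t : 0 <= s -> s <= t -> t <= clen c ->
  mdist (c s) (c t) <= t - s.
Proof.
move=> s0 st tl; rewrite -lee_fin -(curve_arc_length s0 st tl).
exact: curve_length_ge.
Qed.

Lemma curve_near c x (e : R) : 0 <= x <= clen c ->
  forall y, 0 <= y <= clen c -> `|y - x| < e -> ball (c x) e (c y).
Proof.
move=> /andP[x0 xl] y /andP[y0 yl] yx; rewrite ballEmdist/=.
have [xy|/ltW yx'] := leP x y.
  by apply: le_lt_trans (curve_lip x0 xy yl) _; rewrite ger0_norm ?subr_ge0 in yx.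
rewrite metric_sym; apply: le_lt_trans (curve_lip y0 yx' xl) _.
by rewrite distrC ger0_norm ?subr_ge0 in yx.
Qed.

Lemma open_borel (O : set X) : open O -> measurable (O : set (borel X)).
Proof. by move=> oO; apply: sub_sigma_algebra. Qed.

(** Curves are 1-Lipschitz on [`[0, clen c]], so the preimage of an open set is
    the trace of an open set there. *)
Lemma measurable_curve c : measurable_fun `[0, clen c] (c : R -> borel X).
Proof.
apply: (@measurability _ _ _ (borel X) _ _ (@open X)) => //.
move=> _ [U oU <-].
pose W := [set y : R | exists x e, [/\ 0 <= x <= clen c, `|y - x| < e
   & ball (c x) e `<=` U]].
have -> : `[0, clen c] `&` c @^-1` U = `[0, clen c] `&` W.
  apply/seteqP; split => y /= [yl]; rewrite in_itv/= in yl => cU; split => //.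
    have /(@nbhs_ballP _ X)[e/= e0 eU] := open_nbhs_nbhs (conj oU cU).
    by exists y, e; split => //; rewrite subrr normr0.
  by case: cU => x [e [xl xe eU]]; apply: eU; exact: curve_near.
apply: measurableI => //; apply: open_measurable.
rewrite openE => y [x [e [xl xe eU]]].
apply/nbhs_ballP; exists (e - `|y - x|) => /=; first by rewrite subr_gt0.
move=> z; rewrite /ball/= => yz; exists x, e; split => //.
have -> : z - x = (y - x) - (y - z) by ring.
by rewrite (le_lt_trans (ler_normB _ _))// -ltrBrDl.
Qed.

Lemma measurable_comp_curve c g : measurable_fun [set: borel X] g ->
  measurable_fun `[0, clen c] (g \o c).
Proof.
move=> mg; apply: (@measurable_comp _ _ _ _ (borel X) _ setT) => //.
exact: measurable_curve.
Qed.

Lemma nonneg_borel_along c g : nonneg_borel_on setT g ->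
  measurable_fun [set: R] (along c g) /\ forall x, (0 <= along c g x)%E.
Proof.
move=> [mg g0]; split; last by move=> x; apply: erestrict_ge0 => y _; exact: g0.
by apply: (iffLR (measurable_restrictT _ _)) => //; exact: measurable_comp_curve.
Qed.

Lemma line_integral_along c g : nonneg_borel_on setT g ->
  line_integral c g = (\int[mu]_(x in `]0%R, clen c]) along c g x)%E.
Proof.
move=> bg; have [mg _] := nonneg_borel_along c bg.
rewrite integral_itv_obnd_cbnd; last exact: measurable_funTS.
apply: eq_integral => x; rewrite inE/= => xl; rewrite /along patchE mem_set//=.
Qed.

Lemma along_density c g : nonneg_borel_on setT g ->
  (line_integral c g < +oo)%E -> density (clen c) (along c g).
Proof.
move=> bg; rewrite line_integral_along// => lg.
by have [mg g0] := nonneg_borel_along c bg; split.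
Qed.

(** Partitions translate; the converse inequality is the direct one for the
    opposite shift. *)
Lemma curve_length_shift (gamma : R -> X) (r a b : R) :
  curve_length (fun x => gamma (r + x)) a b = curve_length gamma (r + a) (r + b).
Proof.
have le (g : R -> X) (v a' b' : R) : (curve_length (fun x => g (v + x)%R) a' b' <=
    curve_length g (v + a')%R (v + b')%R)%E.
  apply: ge_ereal_sup => _ [s ps <-]; apply: ereal_sup_ubound.
  exists (map (fun x => v + x) s).
    case: ps => ps ls; split.
      by rewrite path_map; apply: sub_path ps => x y /=; rewrite ltrD2l.
    by rewrite last_map (eqP ls).
  rewrite size_map; congr _%:E; apply: eq_big_nat => k /andP[_ ks].
  have nthE j : nth (v + b') (v + a' :: map (fun x => v + x) s) j =
      v + nth b' (a' :: s) j.
    have [js|js] := ltnP j (size (a' :: s)).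
      by rewrite -[_ :: map _ _]/(map (fun x => v + x) (a' :: s)) (nth_map b').
    by rewrite !nth_default//= size_map.
  by rewrite !nthE.
apply/eqP; rewrite eq_le le/=.
have := le (fun x => gamma (r + x)) (- r) (r + a) (r + b).
rewrite !addKr; congr (_ <= _)%E; congr curve_length.
by apply/funext => x; rewrite addrA subrr add0r.
Qed.

Definition subcurve c s t (s0 : 0 <= s) (st : s <= t) (tl : t <= clen c) :
  @curve R X.
Proof.
refine (@Curve R X (fun x => c (s + x)) (t - s) _ _); first by rewrite subr_ge0.
move=> a b a0 ab bl; rewrite curve_length_shift curve_arc_length.
- by congr _%:E; ring.
- exact: addr_ge0.
- by rewrite lerD2l.
- by apply: le_trans tl; rewrite -lerBrDl.
Defined.

Lemma line_integral_subcurve c s t (s0 : 0 <= s) (st : s <= t)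
    (tl : t <= clen c) g : nonneg_borel_on setT g ->
  line_integral (subcurve s0 st tl) g =
  (\int[mu]_(x in `]s, t]) along c g x)%E.
Proof.
move=> bg; have [mg g0] := nonneg_borel_along c bg.
rewrite integral_itv_obnd_cbnd; last exact: measurable_funTS.
have := ge0_integral_shift s 0 (t - s) mg g0.
rewrite addr0 [s + (t - s)]addrC subrK => <-.
rewrite /line_integral/=; apply: eq_integral => x.
rewrite inE/= in_itv/= => /andP[x0 xl]; rewrite /along patchE mem_set//=.
by rewrite in_itv/= addr_ge0//= (le_trans _ tl)// -lerBrDl.
Qed.

Definition infinite_along (rho : X -> \bar R) : set curve :=
  [set c | line_integral c rho = +oo%E].

Lemma ge0_line_integralZ c (k : R) rho : nonneg_borel_on setT rho -> 0 <= k ->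
  line_integral c (fun x => k%:E * rho x)%E = (k%:E * line_integral c rho)%E.
Proof.
move=> [mr r0] k0; rewrite /line_integral ge0_integralZl_EFin//.
  by move=> x _; exact: r0.
exact: measurable_comp_curve.
Qed.

Lemma ge0_line_integralD c f g : nonneg_borel_on setT f ->
  nonneg_borel_on setT g ->
  line_integral c (fun x => f x + g x)%E =
  (line_integral c f + line_integral c g)%E.
Proof.
move=> [mf f0] [mg g0]; rewrite /line_integral ge0_integralD//.
- by move=> x _; exact: f0.
- exact: measurable_comp_curve.
- by move=> x _; exact: g0.
- exact: measurable_comp_curve.
Qed.

Lemma ge0_line_integral_series c (f : nat -> X -> \bar R) :
  (forall n, nonneg_borel_on setT (f n)) ->
  line_integral c (fun x => \sum_(n <oo) f n x)%E =
  (\sum_(n <oo) line_integral c (f n))%E.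
Proof.
move=> bf; rewrite /line_integral integral_nneseries//.
- by move=> n; case: (bf n) => mf _; exact: measurable_comp_curve.
- by move=> n x _; case: (bf n) => _; exact.
Qed.

End Curves.

(** * Almost everywhere statements on the Borel space *)

(** Points are usually typed in [X] and not in [borel X], which prevents the
    inference of the filter [almost_everywhere nu]; these are the filter rules
    at that type. *)
Section AlmostEverywhere.
Context {R : realType} {X : completeMetricType R}.
Context (nu : {measure set (borel X) -> \bar R}).
Implicit Types P Q T S : X -> Prop.

Lemma ae_imp P Q : (forall x, P x -> Q x) ->
  {ae nu, forall x, P x} -> {ae nu, forall x, Q x}.
Proof. by move=> PQ; apply: (@filterS (borel X)). Qed.

Lemma ae_imp2 P Q S : (forall x, P x -> Q x -> S x) ->
  {ae nu, forall x, P x} -> {ae nu, forall x, Q x} -> {ae nu, forall x, S x}.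
Proof. by move=> PQ; apply: (@filterS2 (borel X)). Qed.

Lemma ae_imp3 P Q T S : (forall x, P x -> Q x -> T x -> S x) ->
  {ae nu, forall x, P x} -> {ae nu, forall x, Q x} -> {ae nu, forall x, T x} ->
  {ae nu, forall x, S x}.
Proof. by move=> PQ; apply: (@filterS3 (borel X)). Qed.

Lemma ae_forall_nat (P : nat -> X -> Prop) :
  (forall n, {ae nu, forall x, P n x}) -> {ae nu, forall x, forall n, P n x}.
Proof. by move=> /ae_foralln; apply: ae_imp. Qed.

End AlmostEverywhere.

(** * Weak upper gradients, curve by curve *)

Section WeakUpperGradients.
Context {R : realType} {X : completeMetricType R}.
Context (nu : {measure set (borel X) -> \bar R}).
Implicit Types (c : @curve R X) (f g h k rho : X -> \bar R) (u v w : X -> R).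

Definition integrable_borel f : Prop :=
  nonneg_borel_on setT f /\ (\int[nu]_x f x < +oo)%E.

(** This is the same as an integrable 1-weak upper gradient
    ([curvewise_weak_upper_gradient], [weak_upper_gradient_curvewise]).  The
    family of exceptional curves is described by an integrable [rho] with
    infinite integral along them: such families are stable under countable
    unions, and a curve outside of one has all its subcurves outside of it. *)
Definition curvewise_gradient u g : Prop := integrable_borel g /\
  exists2 rho, integrable_borel rho & forall c, (line_integral c rho < +oo)%E ->
    density (clen c) (along c g) /\ controls (clen c) (u \o c) (along c g).

Lemma integrable_borelD f g : integrable_borel f -> integrable_borel g ->
  integrable_borel (fun x => f x + g x)%E.
Proof.
move=> [[mf f0] fi] [[mg g0] gi]; split.
  split; first exact: emeasurable_funD.
  by move=> x _; rewrite adde_ge0 ?f0 ?g0.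
by rewrite ge0_integralD//; exact: lte_add_pinfty.
Qed.

Lemma integrable_borelZ f (r : R) : 0 <= r -> integrable_borel f ->
  integrable_borel (fun x => r%:E * f x)%E.
Proof.
move=> r0 [[mf f0] fi]; split.
  split; first exact: measurable_funeM.
  by move=> x _; rewrite mule_ge0 ?f0.
by rewrite ge0_integralZl_EFin//; exact: lte_mul_pinfty.
Qed.

Lemma integrable_borel_le f g : nonneg_borel_on setT f -> integrable_borel g ->
  (forall x, f x <= g x)%E -> integrable_borel f.
Proof.
move=> [mf f0] [[mg g0] gi] fg; split => //; apply: le_lt_trans gi.
by apply: ge0_le_integral.
Qed.

Lemma integrable_borel0 : integrable_borel (cst 0%E).
Proof. by split; [split|rewrite integral0]. Qed.

Lemma integrable_borel_series (f_ : nat -> X -> \bar R) :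
  (forall n, nonneg_borel_on setT (f_ n)) ->
  (forall n, (\int[nu]_x f_ n x <= (1 / (2 ^ n.+1)%:R)%:E)%E) ->
  integrable_borel (fun x => \sum_(n <oo) f_ n x)%E.
Proof.
move=> bf fi.
have mf n : measurable_fun [set: borel X] (f_ n) by case: (bf n).
have f0 n x : (0 <= f_ n x)%E by case: (bf n) => _; exact.
split; first split.
- by apply: ge0_emeasurable_sum => // n x _ _; exact: f0.
- by move=> x _; apply: nneseries_ge0 => n _ _; exact: f0.
rewrite integral_nneseries//.
apply: (@le_lt_trans _ _ (\sum_(n <oo) (1 / (2 ^ n.+1)%:R)%:E)%E).
  by apply: lee_nneseries => // n _ _; apply: integral_ge0.
by apply: le_lt_trans (epsilon_trick0 xpredT (@ler01 R)) _; rewrite ltry.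
Qed.

(** The factor is [e / (1 + int f)], whose denominator cannot vanish. *)
Lemma integrable_borel_rescale f (e : R) : 0 < e -> integrable_borel f ->
  exists2 r : R, 0 < r & (\int[nu]_x (r%:E * f x) <= e%:E)%E.
Proof.
move=> e0 [[mf f0] fi].
have I0 : (0 <= \int[nu]_x f x)%E by apply: integral_ge0.
pose K := fine (\int[nu]_x f x) + 1.
have K0 : 0 < K by rewrite ltr_wpDl// fine_ge0.
exists (e / K); first exact: divr_gt0.
rewrite ge0_integralZl_EFin//; last by rewrite divr_ge0// ltW.
rewrite -(@fineK _ (\int[nu]_x f x)%E) ?ge0_fin_numE// -EFinM lee_fin mulrAC.
by rewrite ler_pdivrMr// ler_wpM2l ?(ltW e0)// lerDl.
Qed.

(** Rescale the n-th function so that its integral is at most [2^-(n+1)], and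
    sum; a finite sum has finite terms. *)
Lemma infinite_along_bigcup (rho_ : nat -> X -> \bar R) :
  (forall n, integrable_borel (rho_ n)) -> exists2 rho, integrable_borel rho &
  forall c, (line_integral c rho < +oo)%E ->
    forall n, (line_integral c (rho_ n) < +oo)%E.
Proof.
move=> brho.
have /choice[r_ Hr] : forall n, exists r : R, 0 < r /\
    (\int[nu]_x (r%:E * rho_ n x) <= (1 / (2 ^ n.+1)%:R)%:E)%E.
  move=> n; have [|r r0 Hr] := @integrable_borel_rescale (rho_ n)
    (1 / (2 ^ n.+1)%:R) _ (brho n); last by exists r.
  by rewrite divr_gt0// ltr0n expn_gt0.
have bn n : nonneg_borel_on setT (fun x => (r_ n)%:E * rho_ n x)%E.
  by case: (Hr n) => r0 _; case: (integrable_borelZ (ltW r0) (brho n)).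
exists (fun x => \sum_(n <oo) ((r_ n)%:E * rho_ n x))%E.
  by apply: integrable_borel_series => // n; case: (Hr n).
move=> c; rewrite ge0_line_integral_series// => H n.
have [r0 _] := Hr n; have [bnn _] := brho n.
have ge0 m : (0 <= line_integral c (fun x => (r_ m)%:E * rho_ m x))%E.
  by apply: integral_ge0 => x _; case: (bn m) => _; exact.
rewrite ltey; apply/eqP => E; move: H; apply/negP; rewrite -leNgt leye_eq.
rewrite (@nneseriesD1 _ _ n)// ge0_line_integralZ// ?ltW// E gt0_muley ?lte_fin//.
by rewrite addye// gt_eqF// (lt_le_trans (ltNyr 0))//; apply: nneseries_ge0.
Qed.

Lemma modulus_infinite_along rho : integrable_borel rho ->
  modulus1 nu (infinite_along rho) = 0%E.
Proof.
move=> brho; have [[mr r0] ri] := brho.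
apply/eqP; rewrite eq_le; apply/andP; split; last first.
  apply: le_ereal_inf_tmp => _ [f [[_ f0] _] <-].
  by apply: integral_ge0 => x _; exact: f0.
apply/lee_addgt0Pr => e e0; rewrite add0e.
have [r rp Hr] := integrable_borel_rescale e0 brho.
apply: le_trans Hr; apply: ereal_inf_lbound.
exists (fun x => r%:E * rho x)%E => //; split.
  by case: (integrable_borelZ (ltW rp) brho).
move=> c cG; rewrite ge0_line_integralZ//; last exact: ltW.
by rewrite cG gt0_muley ?lte_fin// leey.
Qed.

(** Sum functions admissible for [G] with integrals at most [2^-(n+1)]: along a
    curve of [G] every term contributes at least 1. *)
Lemma modulus0_infinite_along (G : set curve) : modulus1 nu G = 0%E ->
  exists2 rho, integrable_borel rho & G `<=` infinite_along rho.
Proof.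
move=> G0.
have /choice[rho_ Hr] : forall n, exists rho, admissible G rho /\
    (\int[nu]_x rho x <= (1 / (2 ^ n.+1)%:R)%:E)%E.
  move=> n; have e0 : 0 < 1 / (2 ^ n.+1)%:R :> R.
    by rewrite divr_gt0// ltr0n expn_gt0.
  have : modulus1 nu G \is a fin_num by rewrite G0.
  move=> /(lb_ereal_inf_adherent e0)[_ [rho arho <-]].
  by rewrite -/(modulus1 nu G) G0 add0e => H; exists rho; split => //; exact: ltW.
have bn n : nonneg_borel_on setT (rho_ n) by case: (Hr n) => -[].
exists (fun x => \sum_(n <oo) rho_ n x)%E.
  by apply: integrable_borel_series => // n; case: (Hr n).
move=> c Gc; rewrite /infinite_along/= ge0_line_integral_series//.
apply/eqP; rewrite -leye_eq.
apply: (@le_trans _ _ (\sum_(n <oo) 1)%E).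
  suff -> : (\sum_(n <oo) 1 = +oo :> \bar R)%E by [].
  apply/cvg_lim => //; apply/cvgeyPge => A.
  near=> n; rewrite sumEFin lee_fin big_const_nat iter_addr addr0 subn0.
  by near: n; exact: nbhs_infty_ger.
by apply: lee_nneseries => // n *; case: (Hr n) => -[_ H] _; exact: H.
Unshelve. all: by end_near. Qed.

Lemma curvewise_weak_upper_gradient u g : curvewise_gradient u g ->
  weak_upper_gradient nu setT u g.
Proof.
move=> [[bg _] [rho brho H]]; split => //.
exists (infinite_along rho); first exact: modulus_infinite_along.
move=> c _ /eqP; rewrite -ltey => /H[dg cg].
rewrite /upper_gradient_along line_integral_along//.
by apply: cg => //; exact: clen_ge0.
Qed.

(** Apply the upper gradient inequality to all the subcurves of a curve along
    which [rho] and [g] have finite integrals; none of them is exceptional. *)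
Lemma weak_upper_gradient_curvewise u g : weak_upper_gradient nu setT u g ->
  (\int[nu]_x g x < +oo)%E -> curvewise_gradient u g.
Proof.
move=> [bg [G /modulus0_infinite_along[rho brho Grho] H]] gi.
split=> //; exists (fun x => rho x + g x)%E; first exact: integrable_borelD.
move=> c; have [br _] := brho; rewrite ge0_line_integralD// => rg.
have [rfin gfin] : (line_integral c rho < +oo)%E /\ (line_integral c g < +oo)%E.
  have r0 : (0 <= line_integral c rho)%E.
    by apply: integral_ge0 => x _; case: br => _; exact.
  have g0 : (0 <= line_integral c g)%E.
    by apply: integral_ge0 => x _; case: bg => _; exact.
  by split; apply: le_lt_trans rg; [rewrite leeDl|rewrite leeDr].
split; first exact: along_density.
move=> s t s0 st tl; rewrite -(line_integral_subcurve s0 st tl)//.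
have -> : (u \o c) t = u ((subcurve s0 st tl) (clen (subcurve s0 st tl))).
  by rewrite /= [s + _]addrC subrK.
have -> : (u \o c) s = u ((subcurve s0 st tl) 0) by rewrite /= addr0.
apply: H => // /Grho; rewrite /infinite_along/= line_integral_subcurve// => E.
have := density_fin (along_density br rfin) s0 tl.
by rewrite E ltxx.
Qed.

(** If [g] is a 1-weak upper gradient with exceptional curves given by [rho],
    then [g + rho] is a genuine upper gradient. *)
Lemma D11_curvewise u :
  D11 nu u <-> measurable_fun [set: borel X] u /\ exists g, curvewise_gradient u g.
Proof.
split=> -[mu H]; split => //.
  case: H => g [bg Hg] gi; exists g; apply: weak_upper_gradient_curvewise => //.
  split => //; exists set0 => //; have := modulus_infinite_along integrable_borel0.
  suff -> : infinite_along (cst 0%E) = set0 :> set (@curve R X) by [].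
  by apply/seteqP; split => // c; rewrite /infinite_along/= /line_integral integral0.
case: H => g [bg [rho brho H]].
have [bs si] := integrable_borelD bg brho.
exists (fun x => g x + rho x)%E => //; split => // c.
have [bg' _] := bg; have [br' _] := brho.
rewrite /upper_gradient_along ge0_line_integralD//.
have [E|] := eqVneq (line_integral c rho) +oo%E.
  rewrite E addey ?leey// gt_eqF// (lt_le_trans (ltNyr 0))//.
  by apply: integral_ge0 => x _; case: bg' => _; exact.
rewrite -ltey => /H[_ cg].
apply: (@le_trans _ _ (line_integral c g)); last first.
  by rewrite leeDl//; apply: integral_ge0 => x _; case: br' => _; exact.
by rewrite line_integral_along//; apply: cg => //; exact: clen_ge0.
Qed.

(** Transfers an implication between densities along one curve to gradients:
    the exceptional curves of the two hypotheses and those along which [k] is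
    not integrable are discarded together. *)
Lemma curvewise_lift2 u v w g h k : curvewise_gradient u g ->
  curvewise_gradient v h -> integrable_borel k ->
  (forall c, density (clen c) (along c g) -> density (clen c) (along c h) ->
     density (clen c) (along c k) -> controls (clen c) (u \o c) (along c g) ->
     controls (clen c) (v \o c) (along c h) ->
     controls (clen c) (w \o c) (along c k)) ->
  curvewise_gradient w k.
Proof.
move=> [_ [r1 b1 H1]] [_ [r2 b2 H2]] bk H; split => //.
pose rho_ (n : nat) := if n == 0%N then r1 else if n == 1%N then r2 else k.
have [|rho brho Hrho] := @infinite_along_bigcup rho_.
  by move=> [|[|n]].
exists rho => // c /Hrho cr.
have [d1 c1] := H1 c (cr 0%N); have [d2 c2] := H2 c (cr 1%N).
have [bk' _] := bk; have dk := along_density bk' (cr 2%N).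
by split => //; exact: H.
Qed.

Lemma along_map2 (F : \bar R -> \bar R -> \bar R) c g h : F 0%E 0%E = 0%E ->
  along c (fun x => F (g x) (h x)) = fun t => F (along c g t) (along c h t).
Proof.
by move=> F0; apply/funext => t; rewrite /along !patchE; case: ifP; rewrite ?F0.
Qed.

Lemma curvewise_lift1 u w g k : curvewise_gradient u g -> integrable_borel k ->
  (forall c, density (clen c) (along c g) -> density (clen c) (along c k) ->
     controls (clen c) (u \o c) (along c g) ->
     controls (clen c) (w \o c) (along c k)) ->
  curvewise_gradient w k.
Proof. by move=> ug bk H; apply: (curvewise_lift2 ug ug bk) => c *; exact: H. Qed.

Lemma curvewise_min u g h : curvewise_gradient u g -> curvewise_gradient u h ->
  curvewise_gradient u (fun x => Order.min (g x) (h x)).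
Proof.
move=> ug uh; have [bg _] := ug; have [bh _] := uh.
have [[mg g0] _] := bg; have [[mh h0] _] := bh.
apply: (curvewise_lift2 ug uh).
  apply: (integrable_borel_le _ bg); last by move=> x; rewrite ge_min lexx.
  by split; [exact: measurable_mine|move=> x _; rewrite le_min g0 ?h0].
move=> c dg dh _ cg ch; rewrite (@along_map2 Order.min)//; last by rewrite minxx.
exact: controls_min.
Qed.

Lemma curvewise_lip u g (F : R -> R) (K : R) : 0 <= K ->
  (forall a b, `|F a - F b| <= K * `|a - b|) ->
  curvewise_gradient u g ->
  curvewise_gradient (fun x => F (u x)) (fun x => K%:E * g x)%E.
Proof.
move=> K0 lipF ug; have [bg _] := ug.
apply: (curvewise_lift1 ug); first exact: integrable_borelZ.
move=> c dg _ cg s t s0 st tl /=.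
rewrite (@along_map2 (fun a _ => K%:E * a)%E c g g) ?mule0//.
have [mg g0 _] := dg.
rewrite ge0_integralZl_EFin//; last exact: measurable_funTS.
apply: (@le_trans _ _ (K%:E * `|u (c t) - u (c s)|%:E)%E).
  by rewrite -EFinM lee_fin.
by rewrite lee_wpmul2l//; exact: cg.
Qed.

Lemma curvewiseD u v g h : curvewise_gradient u g -> curvewise_gradient v h ->
  curvewise_gradient (fun x => u x + v x) (fun x => g x + h x)%E.
Proof.
move=> ug vh; have [bg _] := ug; have [bh _] := vh.
apply: (curvewise_lift2 ug vh); first exact: integrable_borelD.
move=> c dg dh _ cg ch s t s0 st tl /=.
rewrite (@along_map2 (fun a b => a + b)%E)//; last by rewrite adde0.
have [mg g0 _] := dg; have [mh h0 _] := dh.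
rewrite ge0_integralD//; [|exact: measurable_funTS..].
apply: (@le_trans _ _ (`|u (c t) - u (c s)| + `|v (c t) - v (c s)|)%:E).
  by rewrite lee_fin opprD addrACA ler_normD.
by rewrite EFinD leeD//; [exact: cg|exact: ch].
Qed.

Lemma curvewise_cst (r : R) : curvewise_gradient (cst r) (cst 0%E).
Proof.
split; first exact: integrable_borel0.
exists (cst 0%E); first exact: integrable_borel0.
move=> c H; split; first by apply: along_density => //; case: integrable_borel0.
move=> s t s0 st tl; rewrite /= subrr normr0; apply: integral_ge0 => x _.
by rewrite /along patchE; case: ifP.
Qed.

Lemma curvewiseM u v g h : measurable_fun [set: borel X] u ->
  measurable_fun [set: borel X] v ->
  curvewise_gradient u g -> curvewise_gradient v h ->
  (\int[nu]_x (`|u x|%:E * h x + `|v x|%:E * g x) < +oo)%E ->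
  curvewise_gradient (fun x => u x * v x)
    (fun x => `|u x|%:E * h x + `|v x|%:E * g x)%E.
Proof.
move=> mu mv ug vh ki; have [[[mg g0] _] _] := ug; have [[[mh h0] _] _] := vh.
have E c : along c (fun x => `|u x|%:E * h x + `|v x|%:E * g x)%E =
    fun t => (`|(u \o c) t|%:E * along c h t + `|(v \o c) t|%:E * along c g t)%E.
  apply/funext => t; rewrite /along !patchE; case: ifP => //.
  by rewrite !mule0 adde0.
apply: (curvewise_lift2 ug vh).
  split => //; split; last by move=> x _; rewrite adde_ge0 ?mule_ge0 ?g0 ?h0.
  by apply: emeasurable_funD; apply: emeasurable_funM => //;
    apply/measurable_EFinP; apply: measurableT_comp.
by move=> c dg dh; rewrite E => dk cg ch; exact: controlsM.
Qed.

(** The topological hypothesis is on the times of each curve, where continuity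
    of [u] is available; [u] itself is not continuous. *)
Lemma curvewise_restrict u g v (U : set X) : measurable (U : set (borel X)) ->
  curvewise_gradient u g -> curvewise_gradient v g ->
  (forall c, controls (clen c) (u \o c) (along c g) ->
     density (clen c) (along c g) ->
     forall t, 0 <= t <= clen c -> exists2 d : R, 0 < d &
     (forall s, 0 <= s <= clen c -> `|s - t| < d -> U (c s)) \/
     (forall s, 0 <= s <= clen c -> `|s - t| < d -> v (c s) = v (c t))) ->
  curvewise_gradient v (g \_ U).
Proof.
move=> mU ug vg H; have [bg _] := ug; have [[mg g0] gi] := bg.
apply: (curvewise_lift2 ug vg).
  apply: (integrable_borel_le _ bg).
    split; last by move=> x _; apply: erestrict_ge0 => y _; exact: g0.
    by apply: (iffLR (measurable_restrictT _ _)) => //; exact: measurable_funTS.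
  by move=> x; rewrite patchE; case: ifP => // _; exact: g0.
move=> c dg _ + cu cv.
have -> : along c (g \_ U) = fun t => if t \in c @^-1` U then along c g t else 0%E.
  apply/funext => t; rewrite /along /= !patchE/= !patchE.
  rewrite [in RHS](_ : (t \in c @^-1` U) = (c t \in U)).
    by case: ifP => _ //; case: ifP.
  by apply/idP/idP; rewrite !inE.
by move=> dk; apply: controls_restrict => // t tl; exact: H.
Qed.

(** Exceptional curves of the whole sequence are discarded at once; along the
    others the first gradient dominates the sequence. *)
Lemma curvewise_decreasing u (g_ : nat -> X -> \bar R) :
  (forall n, curvewise_gradient u (g_ n)) ->
  (forall x, nonincreasing_seq (g_ ^~ x)) ->
  curvewise_gradient u (fun x => ereal_inf (range (g_ ^~ x))).
Proof.
move=> ug ndg; pose g x := ereal_inf (range (g_ ^~ x)).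
have cvg x : g_ ^~ x @ \oo --> g x by exact: ereal_nonincreasing_cvgn.
have g_0 n x : (0 <= g_ n x)%E by case: (ug n) => -[[_ g0] _] _; exact: g0.
have gg_ n x : (g x <= g_ n x)%E by apply: ereal_inf_lbound; exists n.
have bg : integrable_borel g.
  have [b0 _] := ug 0%N; apply: (integrable_borel_le _ b0) => //; split.
    apply: (@emeasurable_fun_cvg _ (borel X) _ setT g_) => //.
    by move=> n; case: (ug n) => -[[]].
  by move=> x _; apply: le_ereal_inf_tmp => _ [n _ <-].
split => //.
have /choice[rho_ Hr] : forall n, exists rho, integrable_borel rho /\
    forall c, (line_integral c rho < +oo)%E ->
    density (clen c) (along c (g_ n)) /\ controls (clen c) (u \o c) (along c (g_ n)).
  by move=> n; case: (ug n) => _ [rho]; exists rho.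
have [|rho brho Hrho] := @infinite_along_bigcup rho_.
  by move=> n; case: (Hr n).
exists rho => // c /Hrho cr.
have dn n : density (clen c) (along c (g_ n)) by case: (Hr n) => _ /(_ c (cr n))[].
have [bg' _] := bg.
have [mgc gc0] := nonneg_borel_along c bg'.
have le0 x : (along c g x <= along c (g_ 0%N) x)%E.
  by rewrite /along !patchE; case: ifP => // _; exact: gg_.
split.
  split => //; have [m0 p0 i0] := dn 0%N; apply: le_lt_trans i0.
  by apply: ge0_le_integral => //; exact: measurable_funTS.
apply: (controls_cvg (dn 0%N) dn) => //.
- by move=> n; case: (Hr n) => _ /(_ c (cr n))[].
- move=> n x; rewrite /along !patchE; case: ifP => // _ /=.
  by apply: ndg.
- move=> x; rewrite /along; under eq_fun do rewrite patchE; rewrite patchE.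
  by case: ifP => _; [exact: cvg|exact: cvg_cst].
Qed.

Lemma le_ge0_integral_ae_le f g : integrable_borel f -> integrable_borel g ->
  (\int[nu]_x f x <= \int[nu]_x Order.min (f x) (g x))%E ->
  {ae nu, forall x, (f x <= g x)%E}.
Proof.
move=> [[mf f0] fi] [[mg g0] gi] H.
pose m x := Order.min (f x) (g x).
have mm : measurable_fun [set: borel X] m by exact: measurable_mine.
have m0 x : (0 <= m x)%E by rewrite le_min f0 ?g0.
have mf' x : (m x <= f x)%E by rewrite ge_min lexx.
have intm : nu.-integrable setT m.
  apply/integrableP; split => //; under eq_integral do rewrite gee0_abs//.
  by apply: le_lt_trans fi; apply: ge0_le_integral.
have : ae_eq nu setT m f.
  apply: integral_ae_eq => // E _ mE.
  have le A : measurable A -> (\int[nu]_(x in A) m x <= \int[nu]_(x in A) f x)%E.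
    by move=> mA; apply: ge0_le_integral => //; exact: measurable_funTS.
  apply/eqP; rewrite eq_le le//= leNgt; apply/negP => lt.
  have mCE := measurableC mE.
  have fE A : measurable A -> (\int[nu]_(x in A) f x < +oo)%E.
    by move=> mA; apply: le_lt_trans fi; apply: ge0_subset_integral.
  have f0' x : (0 <= f x)%E by exact: f0.
  move: H; apply/negP; rewrite -ltNge -/m.
  rewrite (ge0_integral_setUC nu mE mm)// (ge0_integral_setUC nu mE mf)//.
  by rewrite lte_leD ?le// ge0_fin_numE ?integral_ge0// (le_lt_trans (le _ _)) ?fE.
by apply: filterS => x /(_ Logic.I); rewrite /m => <-; rewrite ge_min lexx orbT.
Qed.

End WeakUpperGradients.

(** * The minimal weak upper gradient and its calculus *)

Section MinimalWeakUpperGradient.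
Context {R : realType} {X : completeMetricType R}.
Context (nu : {measure set (borel X) -> \bar R}).
Implicit Types (c : @curve R X) (f g h k rho : X -> \bar R) (u v w : X -> R).

(** Take gradients whose integrals approach the infimum; their successive minima
    decrease to a gradient [G] realizing it.  For any other [h], the minimum of
    [G] and [h] is a gradient, so its integral is not smaller than that of [G],
    which forces [G <= h] almost everywhere. *)
Lemma curvewise_minimal u : (exists g, curvewise_gradient nu u g) ->
  exists g, minimal_weak_upper_gradient nu u g.
Proof.
move=> [g0 ug0].
pose S := [set (\int[nu]_x g x)%E | g in curvewise_gradient nu u].
pose I := ereal_inf S.
have ug_ge0 g : curvewise_gradient nu u g -> forall x, (0 <= g x)%E.
  by move=> -[[[_ ge0] _] _] x; exact: ge0.
have I0 : (0 <= I)%E.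
  apply: le_ereal_inf_tmp => _ [g ug <-]; apply: integral_ge0 => x _.
  exact: ug_ge0 ug x.
have Ifin : I \is a fin_num.
  rewrite ge0_fin_numE//; apply: (@le_lt_trans _ _ (\int[nu]_x g0 x)%E).
    by apply: ereal_inf_lbound; exists g0.
  by case: ug0 => -[].
have /choice[h_ Hh] : forall n : nat, exists h, curvewise_gradient nu u h /\
    (\int[nu]_x h x < I + (n.+1%:R^-1)%:E)%E.
  move=> n; have e0 : 0 < n.+1%:R^-1 :> R by rewrite invr_gt0.
  by have [_ [h uh <-] H] := lb_ereal_inf_adherent e0 Ifin; exists h.
pose H_ := fix H_ n x : \bar R :=
  if n is n'.+1 then Order.min (H_ n' x) (h_ n x) else h_ 0%N x.
have uH n : curvewise_gradient nu u (H_ n).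
  elim: n => [|n IH]; first by case: (Hh 0%N).
  by apply: curvewise_min => //; case: (Hh n.+1).
have Hn n x : (H_ n x <= h_ n x)%E.
  by case: n => [|n] //=; rewrite ge_min lexx orbT.
have ndH x : nonincreasing_seq (H_ ^~ x).
  by apply/nonincreasing_seqP => n /=; rewrite ge_min lexx.
have uG := curvewise_decreasing uH ndH.
set G := fun x => _ in uG; exists G.
have GI : (\int[nu]_x G x <= I)%E.
  apply/lee_addgt0Pr => e e0.
  near \oo => n.
  have [uhn hn] := Hh n.
  have [[[mG G0] _] _] := uG; have [[[mh h0] _] _] := uhn.
  apply: (@le_trans _ _ (\int[nu]_x h_ n x)%E).
    apply: ge0_le_integral => // x _; apply: le_trans (Hn n x).
    by apply: ereal_inf_lbound; exists n.
  apply: (le_trans (ltW hn)); rewrite leeD2l// lee_fin.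
  by apply: ltW; near: n; exact: (near_infty_natSinv_lt (PosNum e0)).
split; first exact: curvewise_weak_upper_gradient.
  by case: uG => -[].
move=> h /weak_upper_gradient_curvewise/[apply] uh.
apply: (@le_ge0_integral_ae_le _ _ nu); [by case: uG|by case: uh|].
apply: (le_trans GI); apply: ereal_inf_lbound; exists (fun x => Order.min (G x) (h x)) => //.
exact: curvewise_min.
Unshelve. all: by end_near. Qed.

Lemma Dnorm_curvewise u : (exists g, curvewise_gradient nu u g) ->
  curvewise_gradient nu u (Dnorm nu u).
Proof.
move=> /curvewise_minimal[g mg].
have [w i _] : minimal_weak_upper_gradient nu u (Dnorm nu u).
  exact: (xgetI _ mg).
exact: weak_upper_gradient_curvewise.
Qed.

Lemma Dnorm_integrable_borel u : integrable_borel nu (Dnorm nu u).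
Proof.
rewrite /Dnorm; case: xgetP => [g _ [[bg _] gi _]|_]; first by split.
exact: integrable_borel0.
Qed.

Lemma Dnorm_ge0 u x : (0 <= Dnorm nu u x)%E.
Proof. by have [[_ D0] _] := Dnorm_integrable_borel u; exact: D0. Qed.

Lemma measurable_Dnorm u : measurable_fun [set: borel X] (Dnorm nu u).
Proof. by have [[]] := Dnorm_integrable_borel u. Qed.

Lemma Dnorm_ae_le u h : curvewise_gradient nu u h ->
  {ae nu, forall x, (Dnorm nu u x <= h x)%E}.
Proof.
move=> uh; have [[[_ h0] hi] _] := uh.
rewrite /Dnorm; case: xgetP => [g _ [_ _ H]|_].
  by apply: H => //; exact: curvewise_weak_upper_gradient.
by apply/aeW => x; exact: h0.
Qed.

Lemma D11_Dnorm u : D11 nu u -> curvewise_gradient nu u (Dnorm nu u).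
Proof. by move=> /D11_curvewise[_]; exact: Dnorm_curvewise. Qed.

Lemma D11_measurable u : D11 nu u -> measurable_fun [set: borel X] u.
Proof. by case. Qed.

Lemma D11_cst (r : R) : D11 nu (cst r).
Proof. by apply/D11_curvewise; split=> //; exists (cst 0%E); exact: curvewise_cst. Qed.

Lemma curvewise_sum u v : D11 nu u -> D11 nu v ->
  curvewise_gradient nu (fun x => u x + v x)
    (fun x => Dnorm nu u x + Dnorm nu v x)%E.
Proof. by move=> /D11_Dnorm ug /D11_Dnorm vg; exact: curvewiseD. Qed.

Lemma D11D u v : D11 nu u -> D11 nu v -> D11 nu (fun x => u x + v x).
Proof.
move=> du dv; apply/D11_curvewise; split; last by eexists; exact: curvewise_sum.
by apply: measurable_funD; exact: D11_measurable.
Qed.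

Lemma lip_measurable (F : R -> R) (K : R) : 0 <= K ->
  (forall a b, `|F a - F b| <= K * `|a - b|) -> measurable_fun [set: R] F.
Proof.
move=> K0 H; apply: continuous_measurable_fun => x.
apply/cvgrPdist_lt => e e0; have K1 : 0 < K + 1 by rewrite ltr_wpDl.
apply/nbhs_ballP; exists (e / (K + 1)) => /=; first exact: divr_gt0.
move=> t; rewrite /ball/= => xt; rewrite (le_lt_trans (H _ _))//.
apply: (@le_lt_trans _ _ ((K + 1) * `|x - t|)); first by rewrite ler_wpM2r// lerDl.
by rewrite mulrC -ltr_pdivlMr.
Qed.

Lemma D11_lip u (F : R -> R) (K : R) : 0 <= K ->
  (forall a b, `|F a - F b| <= K * `|a - b|) -> D11 nu u ->
  D11 nu (fun x => F (u x)).
Proof.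
move=> K0 H du; apply/D11_curvewise; split.
  by apply: measurableT_comp; [exact: lip_measurable H|exact: D11_measurable].
by exists (fun x => K%:E * Dnorm nu u x)%E; apply: curvewise_lip => //; exact: D11_Dnorm.
Qed.

Lemma D11Z u (r : R) : D11 nu u -> D11 nu (fun x => r * u x).
Proof.
move=> du; apply: (@D11_lip _ (fun y => r * y) `|r|) => // a b.
by rewrite -mulrBr normrM.
Qed.

Lemma D11B u v : D11 nu u -> D11 nu v -> D11 nu (fun x => u x - v x).
Proof.
move=> du dv; have := D11D du (D11Z (-1) dv); congr (D11 _ _).
by apply/funext => x; rewrite mulN1r.
Qed.

Lemma Dnorm_cst (r : R) : {ae nu, forall x, Dnorm nu (cst r) x = 0%E}.
Proof.
have := Dnorm_ae_le (curvewise_cst nu r); apply: ae_imp => x H.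
by apply/eqP; rewrite eq_le H Dnorm_ge0.
Qed.

Lemma DnormD u v : D11 nu u -> D11 nu v -> {ae nu, forall x,
  (Dnorm nu (fun y => (u y + v y)%R) x <= Dnorm nu u x + Dnorm nu v x)%E}.
Proof. by move=> du dv; apply: Dnorm_ae_le; exact: curvewise_sum. Qed.

Lemma DnormZ u (r : R) : D11 nu u -> {ae nu, forall x,
  (Dnorm nu (fun y => (r * u y)%R) x <= `|r|%:E * Dnorm nu u x)%E}.
Proof.
move=> du; apply: Dnorm_ae_le.
apply: (@curvewise_lip _ _ _ u _ (fun y => r * y)) => //; last exact: D11_Dnorm.
by move=> a b; rewrite -mulrBr normrM.
Qed.

(** [u v - (a v + b u)] is [(u - a)(v - b)] up to the constant [a b], and adding
    constants does not change gradients.  The bounds on [u] and [v] make the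
    gradient of the product integrable. *)
Lemma curvewise_leibniz u v (a b Mu Mv : R) : D11 nu u -> D11 nu v ->
  (forall x, `|u x| <= Mu) -> (forall x, `|v x| <= Mv) ->
  curvewise_gradient nu (fun x => u x * v x - (a * v x + b * u x))
    (fun x => `|u x - a|%:E * Dnorm nu v x + `|v x - b|%:E * Dnorm nu u x)%E.
Proof.
move=> du dv bu bv.
have dua : D11 nu (fun x => u x - a) by apply: D11B => //; exact: D11_cst.
have dvb : D11 nu (fun x => v x - b) by apply: D11B => //; exact: D11_cst.
have mua := D11_measurable dua; have mvb := D11_measurable dvb.
have [bDu iDu] := Dnorm_integrable_borel u.
have [bDv iDv] := Dnorm_integrable_borel v.
have Bu x : `|u x - a| <= Mu + `|a| by rewrite (le_trans (ler_normB _ _))// lerD2r.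
have Bv x : `|v x - b| <= Mv + `|b| by rewrite (le_trans (ler_normB _ _))// lerD2r.
have Mu0 : 0 <= Mu + `|a| := le_trans (normr_ge0 _) (Bu point).
have Mv0 : 0 <= Mv + `|b| := le_trans (normr_ge0 _) (Bv point).
have shift w r : curvewise_gradient nu w (Dnorm nu w) ->
    curvewise_gradient nu (fun x => w x - r) (Dnorm nu w).
  move=> ww; have := @curvewise_lip _ _ _ _ _ (fun y => y - r) 1 ler01 _ ww.
  rewrite (_ : (fun x => 1%:E * Dnorm nu w x)%E = Dnorm nu w); last first.
    by apply/funext => x; rewrite mul1e.
  by apply => x y; rewrite mul1r opprB addrA subrK.
have := @curvewiseM _ _ nu (fun x => u x - a) (fun x => v x - b) (Dnorm nu u) (Dnorm nu v)
  mua mvb (shift _ _ (D11_Dnorm du)) (shift _ _ (D11_Dnorm dv)).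
have fin : (\int[nu]_x (`|u x - a|%:E * Dnorm nu v x + `|v x - b|%:E * Dnorm nu u x) < +oo)%E.
  have := integrable_borelD (integrable_borelZ Mu0 (Dnorm_integrable_borel v))
    (integrable_borelZ Mv0 (Dnorm_integrable_borel u)).
  move=> [[mB B0]]; apply: le_lt_trans; apply: ge0_le_integral => //.
  - by move=> x _; rewrite adde_ge0// mule_ge0// Dnorm_ge0.
  - by apply: emeasurable_funD; apply: emeasurable_funM;
      try exact: measurable_Dnorm; apply/measurable_EFinP; apply: measurableT_comp.
  - by move=> x _; rewrite leeD// lee_wpmul2r ?Dnorm_ge0// lee_fin.
move=> /(_ fin) H.
have := @curvewise_lip _ _ _ _ _ (fun y => y - a * b) 1 ler01 _ H.
set g := (fun x => _ + _)%E.
rewrite (_ : (fun x => 1%:E * g x)%E = g); last first.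
  by apply/funext => x; rewrite mul1e.
rewrite (_ : (fun x => (u x - a) * (v x - b) - a * b) =
  (fun x => u x * v x - (a * v x + b * u x))); last by apply/funext => x; ring.
by apply => x y; rewrite mul1r opprB addrA subrK.
Qed.

Lemma D11M u v (Mu Mv : R) : D11 nu u -> D11 nu v ->
  (forall x, `|u x| <= Mu) -> (forall x, `|v x| <= Mv) ->
  D11 nu (fun x => u x * v x).
Proof.
move=> du dv bu bv; apply/D11_curvewise; split.
  by apply: measurable_funM; exact: D11_measurable.
have := curvewise_leibniz 0 0 du dv bu bv; set g := fun x => (_ + _)%E.
rewrite (_ : (fun x => _ - _) = (fun x => u x * v x)); first by exists g.
by apply/funext => x; rewrite !mul0r addr0 subr0.
Qed.

Lemma ball_borel (x : X) (r : R) : measurable (ball x r : set (borel X)).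
Proof.
apply: open_borel; rewrite openE => y xy; apply/nbhs_ballP.
rewrite ballEmdist/= in xy.
exists (r - mdist x y) => /=; first by rewrite subr_gt0.
move=> z; rewrite !ballEmdist/= => yz.
by rewrite (le_lt_trans (metric_triangle _ y _))// -ltrBrDl.
Qed.

Lemma lipschitz_measurable u (L : R) :
  (forall x y, `|u x - u y| <= L * mdist x y) ->
  measurable_fun [set: borel X] u.
Proof.
move=> H; apply: (measurability _ (RGenOpens.measurableE R)).
move=> _ [_ [a [b ->]] <-]; rewrite setTI; apply: open_borel.
rewrite openE => x /= xab.
have L1 : 0 < Num.max L 0 + 1 by rewrite ltr_wpDl// le_max lexx orbT.
have /nbhs_ballP[e /= e0 He] : nbhs (u x) (`]a, b[%classic : set R).
  by apply: open_nbhs_nbhs; split => //; exact: interval_open.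
apply/nbhs_ballP; exists (e / (Num.max L 0 + 1)) => /=; first exact: divr_gt0.
move=> y; rewrite ballEmdist/= => xy; apply: He; rewrite /ball/=.
rewrite (le_lt_trans (H _ _))//.
apply: (@le_lt_trans _ _ ((Num.max L 0 + 1) * mdist x y)).
  by rewrite ler_wpM2r ?mdist_ge0// -[leLHS]addr0 lerD// le_max lexx.
by rewrite mulrC -ltr_pdivlMr.
Qed.

(** Along a curve, [T \o u] vanishes near the times where [|u| < m], and near
    the others [|u| > m - 1]; the margin 1 leaves room for continuity. *)
Lemma curvewise_truncation u g (m : R) (T : R -> R) :
  measurable_fun [set: borel X] u ->
  curvewise_gradient nu u g -> (forall a b, `|T a - T b| <= `|a - b|) ->
  (forall a, `|a| <= m -> T a = 0) ->
  curvewise_gradient nu (fun x => T (u x)) (g \_ [set x | m - 1 < `|u x|]).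
Proof.
move=> mu ug T1 T0.
have mU : measurable [set x : borel X | m - 1 < `|u x|].
  rewrite -[X in measurable X]setTI; apply: measurable_fun_ltr => //.
  exact: measurableT_comp.
have Tg : curvewise_gradient nu (fun x => T (u x)) g.
  have := @curvewise_lip _ _ nu u g T 1 ler01 _ ug.
  rewrite (_ : (fun x => 1%:E * g x)%E = g); last first.
    by apply/funext => x; rewrite mul1e.
  by apply => a b; rewrite mul1r.
apply: (curvewise_restrict mU ug Tg) => c cu dg t tl.
have [um|um] := ltP `|u (c t)| m.
  have um0 : 0 < m - `|u (c t)| by rewrite subr_gt0.
  have [d d0 Hd] := controls_continuous dg cu tl um0.
  exists d => //; right => s /andP[s0 sl] st /=.
  have um' : `|u (c s)| <= m.
    have -> : u (c s) = u (c t) + (u (c s) - u (c t)) by ring.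
    rewrite (le_trans (ler_normD _ _))// -lerBrDl ltW//.
    by apply: Hd.
  by rewrite !T0// ltW.
have [d d0 Hd] := controls_continuous dg cu tl ltr01.
exists d => //; left => s /andP[s0 sl] st /=.
have := Hd s s0 sl st => /= Hs.
have := ler_normB (u (c s)) (u (c s) - u (c t)).
rewrite opprB [X in `|X|]addrC subrK; lra.
Qed.

(** The constant density [L] controls [u] along every curve by arc length; it is
    needed only in the larger ball, outside of which [u] vanishes near each
    time. *)
Lemma curvewise_lipschitz_ball u (L : R) (x0 : X) (r1 r2 : R) : 0 <= L ->
  (forall x y, `|u x - u y| <= L * mdist x y) ->
  (forall x, r1 <= mdist x0 x -> u x = 0) -> r1 < r2 ->
  (nu (ball x0 r2) < +oo)%E ->
  curvewise_gradient nu u (fun x => L%:E * (\1_(ball x0 r2) x)%:E)%E.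
Proof.
move=> L0 lipu u0 r12 fin.
have mB := ball_borel x0 r2.
have bB : integrable_borel nu (fun x => L%:E * (\1_(ball x0 r2) x)%:E)%E.
  apply: (@integrable_borelZ _ _ nu (fun x => (\1_(ball x0 r2) x)%:E)) => //.
  split; last by rewrite integral_indic// setIT.
  split; last by move=> x _; rewrite lee_fin.
  exact/measurable_EFinP/measurable_indic.
split=> //; exists (cst 0%E); first exact: integrable_borel0.
move=> c _.
have da : density (clen c) (cst L%:E).
  split=> //=; rewrite integral_cst//= lebesgue_measure_itv/=.
  by case: ifPn => _; rewrite ?mule0// -EFinB -EFinM ltry.
have ca : controls (clen c) (u \o c) (cst L%:E).
  move=> s t s0 st tl; rewrite /= integral_cst//= lebesgue_measure_itv/= lte_fin.
  have : `|u (c t) - u (c s)| <= L * (t - s).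
    by rewrite (le_trans (lipu _ _))// ler_wpM2l// metric_sym; exact: curve_lip.
  case: ltP => [_|ts]; first by rewrite -EFinB -EFinM lee_fin.
  by rewrite mule0 lee_fin; rewrite (_ : t = s) ?subrr ?mulr0//; apply/eqP; rewrite eq_le ts.
have [bB' _] := bB; have [mac ac0] := nonneg_borel_along c bB'.
have dB : density (clen c) (along c (fun x => L%:E * (\1_(ball x0 r2) x)%:E)%E).
  split=> //; have [_ _ i] := da; apply: le_lt_trans i.
  apply: ge0_le_integral => //; first exact: measurable_funTS.
  move=> x _; rewrite /along patchE; case: ifP => _ //=.
  by rewrite indicE -EFinM lee_fin; case: (_ \in _); rewrite ?mulr1 ?mulr0.
split=> //.
pose U := `[0, clen c]%classic `&` c @^-1` ball x0 r2.
have mU : measurable U by exact: (measurable_curve (measurable_itv _) mB).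
pose a' t := if t \in U then (cst L%:E) t else 0%E : \bar R.
have E t : 0 <= t <= clen c -> along c (fun x => L%:E * (\1_(ball x0 r2) x)%:E)%E t = a' t.
  move=> tl; rewrite /along patchE mem_set//= /a' indicE.
  have -> : (t \in U) = (c t \in (ball x0 r2 : set X)).
    apply/idP/idP; rewrite !inE; first by case.
    by move=> ctB; split.
  by case: (_ \in _); rewrite ?mule1 ?mule0.
have da' : density (clen c) a'.
  apply: (@density_patch _ _ _ (cst 0%E)) => //.
  by split => //; rewrite integral0.
suff ca' : controls (clen c) (u \o c) a'.
  by apply: controls_le ca' => // t tl; rewrite E.
apply: controls_restrict => // t tl.
have [ctr|ctr] := ltP (mdist x0 (c t)) r2.
  exists (r2 - mdist x0 (c t)); first by rewrite subr_gt0.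
  left => s sl st; split => //=.
  have := curve_near tl sl st; rewrite !ballEmdist/= => cts.
  by rewrite (le_lt_trans (metric_triangle _ (c t) _))// -ltrBrDl.
exists (r2 - r1); first by rewrite subr_gt0.
right => s sl st /=; rewrite !u0//; first by rewrite (le_trans _ ctr)// ltW.
have := curve_near tl sl st; rewrite !ballEmdist/= => cts.
have := metric_triangle x0 (c s) (c t); rewrite [mdist (c s) _]metric_sym.
lra.
Qed.

Definition clamp (m : R) (y : R) : R := Num.max (- m) (Num.min m y).

Lemma clamp_lip m a b : `|clamp m a - clamp m b| <= `|a - b|.
Proof.
wlog ab : a b / a <= b.
  by move=> H; have [/H//|/ltW/H] := leP a b; rewrite distrC [leRHS]distrC.
have cab : clamp m a <= clamp m b 
  by rewrite /clamp; case: (leP m a) => ?; case: (leP m b) => ?;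
    case: (leP (- m) m) => ?; case: (leP (- m) a) => ?; case: (leP (- m) b) => ?; lra.
rewrite distrC [leRHS]distrC !ger0_norm ?subr_ge0//.
rewrite /clamp; case: (leP m a) => ?; case: (leP m b) => ?;
    case: (leP (- m) m) => ?; case: (leP (- m) a) => ?; case: (leP (- m) b) => ?; lra.
Qed.

Lemma clamp_id m a : `|a| <= m -> clamp m a = a.
Proof.
by rewrite ler_norml /clamp => /andP[ma am];
  case: (leP m a) => ?; case: (leP (- m) m) => ?; case: (leP (- m) a) => ?; lra.
Qed.

Lemma clamp_bound m a : 0 <= m -> `|clamp m a| <= m.
Proof.
move=> m0; rewrite ler_norml /clamp; apply/andP.
by case: (leP m a) => ?; case: (leP (- m) m) => ?; case: (leP (- m) a) => ?; lra.
Qed.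

Lemma tail_lip m a b : `|(a - clamp m a) - (b - clamp m b)| <= `|a - b|.
Proof.
wlog ab : a b / a <= b.
  by move=> H; have [/H//|/ltW/H] := leP a b; rewrite distrC [leRHS]distrC.
rewrite distrC [leRHS]distrC.
have cab : clamp m a <= clamp m b 
  by rewrite /clamp; case: (leP m a) => ?; case: (leP m b) => ?;
    case: (leP (- m) m) => ?; case: (leP (- m) a) => ?; case: (leP (- m) b) => ?; lra.
have := clamp_lip m b a; rewrite [`|clamp _ _ - _|]ger0_norm ?subr_ge0//.
by rewrite [`|b - a|]ger0_norm ?subr_ge0// => ?; rewrite ger0_norm; lra.
Qed.

End MinimalWeakUpperGradient.

(** * Families and one-forms *)

Lemma dyadic_floor {R : realType} (n : nat) (y : R) :
  `|(Num.floor (2 ^+ n * y))%:~R / 2 ^+ n - y| <= (2 ^+ n)^-1.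
Proof.
have p0 : 0 < 2 ^+ n :> R by rewrite exprn_gt0.
set z := 2 ^+ n * y.
have -> : y = z / 2 ^+ n by rewrite /z mulrAC divff ?mul1r// gt_eqF.
have := floor_le z; have := floorD1_gt z; rewrite intrD => h1 h2.
rewrite -mulrBl normrM [X in _ * X]gtr0_norm ?invr_gt0// ler_piMl ?invr_ge0 ?ltW//.
by rewrite distrC ger0_norm ?subr_ge0// ltrBlDr addrC.
Qed.

Section Families.
Context {R : realType} {X : completeMetricType R}.
Context (nu : {measure set (borel X) -> \bar R}).
Implicit Types (phi : X -> \bar R) (u v f g : X -> R) (F G : @form_family R X).

Definition borel_partition F : Prop :=
  (forall i : idx F, measurable (piece i : set (borel X))) /\
  (trivIset setT (@piece _ _ F) /\ \bigcup_i @piece _ _ F i = setT).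

(** Norms of families are only ever bounded from above, through an explicit
    [phi] defined on the whole space. *)
Definition dominated_family F phi : Prop := forall i : idx F,
  {ae nu, forall x, piece i x -> (Dnorm nu (loc i) x <= phi x)%E}.

(** The integral of a nonnegative function is a supremum over smaller simple
    functions, hence monotone without measurability; it is applied to the
    pointwise norm of a family. *)
Lemma ge0_le_integral_nomeas (f g : X -> \bar R) : (forall x, 0 <= f x)%E ->
  (forall x, f x <= g x)%E -> (\int[nu]_x f x <= \int[nu]_x g x)%E.
Proof.
move=> f0 fg; rewrite !ge0_integralTE//; last by move=> x; exact: le_trans (fg x).
apply: ge_ereal_sup => _ [h hf <-]; apply: ereal_sup_ubound; exists h => // x.
exact: le_trans (fg x).
Qed.

Lemma family_pnormE F (i : idx F) x : borel_partition F -> piece i x ->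
  family_pnorm nu F x = Dnorm nu (loc i) x.
Proof.
move=> [_ [tF _]] ix; rewrite /family_pnorm.
have -> : [set j : idx F | piece j x] = [set i].
  apply/seteqP; split => j /=; last by move=> ->.
  by move=> jx; apply: tF => //; exists x.
by rewrite esum_set1// Dnorm_ge0.
Qed.

Lemma family_pnorm_ge0 F x : (0 <= family_pnorm nu F x)%E.
Proof. by apply: esum_ge0 => i _; exact: Dnorm_ge0. Qed.

Lemma family_pnorm_le F phi : borel_partition F -> dominated_family F phi ->
  {ae nu, forall x, (family_pnorm nu F x <= phi x)%E}.
Proof.
move=> bF dF.
pose P n x := if unpickle n is Some i then
  @piece _ _ F i x -> (Dnorm nu (loc i) x <= phi x)%E else True.
have : {ae nu, forall x, forall n, P n x}.
  apply: ae_forall_nat => n; rewrite /P; case: unpickle => [i|]; first exact: dF.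
  exact/aeW.
apply: ae_imp => x Px; have [_ [_ cF]] := bF.
have [i _ ix] : (\bigcup_i @piece _ _ F i) x by rewrite cF.
by rewrite (family_pnormE bF ix); have := Px (pickle i); rewrite /P pickleK; exact.
Qed.

(** The bound holds off a null set; raising [phi] to [+oo] there makes it hold
    everywhere without changing the integral. *)
Lemma family_norm_le F phi : borel_partition F -> nonneg_borel_on setT phi ->
  dominated_family F phi -> (family_norm nu F <= \int[nu]_x phi x)%E.
Proof.
move=> bF [mphi phi0] /(family_pnorm_le bF)[N [mN N0 HN]].
pose psi x := if x \in N then +oo%E else phi x.
have mpsi : measurable_fun [set: borel X] psi.
  by apply: measurable_fun_ifT => //; exact: measurable_mem.
have psi0 x : (0 <= psi x)%E by rewrite /psi; case: ifP => // _; exact: phi0.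
apply: (@le_trans _ _ (\int[nu]_x psi x)%E).
  apply: ge0_le_integral_nomeas => x; first exact: family_pnorm_ge0.
  rewrite /psi; case: ifPn => [|/negP xN]; first by rewrite leey.
  apply: contrapT => h; apply: xN; apply/mem_set; exact: HN.
rewrite le_eqVlt; apply/orP; left; apply/eqP.
apply: ge0_ae_eq_integral => //.
exists N; split => // x /= h; apply: contrapT => xN; apply: h => _.
by rewrite /psi memNset.
Qed.

(** A finite sum of integrals over disjoint pieces is an integral over their
    union. *)
Lemma precotangent_intro F phi : borel_partition F ->
  (forall i : idx F, D11 nu (loc i)) -> integrable_borel nu phi ->
  dominated_family F phi -> precotangent nu F.
Proof.
move=> bF dF [[mphi phi0] iphi] Fphi; have [mF [tF cF]] := bF; split => //.
apply: le_lt_trans iphi; apply: ge_ereal_sup => _ [A [finA _] <-].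
rewrite fsbig_finite//=.
move: (finmap.fset_uniq (fset_set A)); move: (finmap.enum_fset _) => s us.
have le1 : (\sum_(i <- s) \int[nu]_(x in @piece _ _ F i) Dnorm nu (loc i) x <=
    \sum_(i <- s) \int[nu]_(x in @piece _ _ F i) phi x)%E.
  apply: lee_sum => i _; apply: ae_ge0_le_integral => //.
  - by move=> x _; exact: Dnorm_ge0.
  - by apply: measurable_funTS; exact: measurable_Dnorm.
  - by move=> x _; exact: phi0.
  - exact: measurable_funTS.
apply: (le_trans le1); rewrite -ge0_integral_bigsetU//=.
- by apply: ge0_subset_integral => //; apply: bigsetU_measurable.
- exact: sub_trivIset tF.
- exact: measurable_funTS.
- by move=> x _; exact: phi0.
Qed.

Lemma borel_partition_differential f :
  borel_partition (FormFamily (fun _ : unit => f) (fun=> setT)).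
Proof.
split; first by move=> i; exact: measurableT.
split; first by move=> /= [] [].
by rewrite bigcup_const//; exists tt.
Qed.

Lemma borel_partition_add F G : borel_partition F -> borel_partition G ->
  borel_partition (family_add F G).
Proof.
move=> [mF [tF cF]] [mG [tG cG]]; split; first by move=> [i j]; exact: measurableI.
split.
  move=> [i j] [i' j'] _ _ [x [[/= ix jx] [/= ix' jx']]].
  by congr pair; [apply: tF => //; exists x|apply: tG => //; exists x].
apply/seteqP; split => // x _.
have [i _ ix] : (\bigcup_i @piece _ _ F i) x by rewrite cF.
have [j _ jx] : (\bigcup_i @piece _ _ G i) x by rewrite cG.
by exists (i, j).
Qed.

Lemma borel_partition_sub F G : borel_partition F -> borel_partition G ->
  borel_partition (family_sub F G).
Proof. exact: borel_partition_add. Qed.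

Lemma borel_partition_scale n f F : measurable_fun [set: borel X] f ->
  borel_partition F -> borel_partition (family_scale n f F).
Proof.
move=> mf [mF [tF cF]].
have m2 : measurable_fun [set: borel X] (fun x => 2 ^+ n * f x).
  exact: measurable_funM.
split.
  move=> [i j] /=; apply: measurableI => //.
  have -> : [set x | Num.floor (2 ^+ n * f x) = j] =
    [set: borel X] `&` (fun x => 2 ^+ n * f x) @^-1` `[j%:~R, (j + 1)%:~R[%classic.
    apply/seteqP; split => x /=; rewrite in_itv/=.
      by move=> <-; split => //; rewrite floor_le_tmp floorD1_gt.
    by move=> [_ h]; exact/floor_def.
  exact: m2.
split.
  move=> [i j] [i' j'] _ _ [x [[/= ix jx] [/= ix' jx']]].
  by congr pair; [apply: tF => //; exists x|rewrite -jx -jx'].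
apply/seteqP; split => // x _.
have [i _ ix] : (\bigcup_i @piece _ _ F i) x by rewrite cF.
by exists (i, Num.floor (2 ^+ n * f x)).
Qed.

End Families.

Section OneForms.
Context {R : realType} {X : completeMetricType R}.
Context (nu : {measure set (borel X) -> \bar R}).
Implicit Types (phi psi : X -> \bar R) (u v f g h : X -> R).
Implicit Types (F G : @form_family R X) (w z : @oneform R X).

Local Notation half n := ((2 ^+ n)^-1 : R).

Lemma half_gt0 n : 0 < half n. Proof. by rewrite invr_gt0 exprn_gt0. Qed.

Lemma half_le1 n : half n <= 1.
Proof. by rewrite invf_le1 ?exprn_gt0// exprn_ege1// ler1n. Qed.

Lemma half_cvg0 : (fun n => half n) @ \oo --> (0 : R).
Proof.
have -> : (fun n => half n) = (fun n => 2^-1 ^+ n).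
  by apply/funext => n; rewrite exprVn.
by apply: cvg_expr; rewrite ger0_norm ?invr_ge0// invf_lt1// ltr1n.
Qed.

(** All the sequences of families below have successive differences of size
    [2^-m + 2^-n], the error of the dyadic approximations. *)
Lemma L1cotangent_intro w phi psi : (forall n, borel_partition (w n)) ->
  (forall n i, D11 nu (@loc _ _ (w n) i)) ->
  integrable_borel nu phi -> (forall n, dominated_family nu (w n) phi) ->
  integrable_borel nu psi ->
  (forall m n, dominated_family nu (family_sub (w m) (w n))
     (fun x => (half m + half n)%:E * psi x)%E) ->
  L1cotangent nu w.
Proof.
move=> bw dw iphi wphi ipsi wpsi; split.
  by move=> n; exact: precotangent_intro iphi _.
move=> e e0; have [[mpsi psi0] Ipsi] := ipsi.
have I0 : (0 <= \int[nu]_x psi x)%E by apply: integral_ge0.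
pose K := fine (\int[nu]_x psi x) + 1.
have K0 : 0 < K by rewrite ltr_wpDl// fine_ge0.
have [N _ HN] : \forall n \near \oo, half n < e / (2 * K).
  have := half_cvg0 => /cvgrPdist_lt /(_ (e / (2 * K))).
  rewrite divr_gt0 ?mulr_gt0// => /(_ isT); apply: filterS => n.
  by rewrite sub0r normrN ger0_norm ?ltW ?half_gt0.
exists N => m n Nm Nn.
apply: (@le_lt_trans _ _ (\int[nu]_x ((half m + half n)%:E * psi x))%E).
  apply: family_norm_le => //; first exact: borel_partition_sub.
  by case: (integrable_borelZ (addr_ge0 (ltW (half_gt0 m)) (ltW (half_gt0 n))) ipsi).
rewrite ge0_integralZl_EFin//.
rewrite -(@fineK _ (\int[nu]_x psi x)%E) ?ge0_fin_numE// -EFinM lte_fin.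
apply: (@le_lt_trans _ _ ((half m + half n) * K)).
  by rewrite ler_wpM2l ?lerDl// addr_ge0// ltW// half_gt0.
rewrite -ltr_pdivlMr//; have -> : e / K = e / (2 * K) + e / (2 * K).
  by rewrite invfM; lra.
by rewrite ltrD//; exact: HN.
Qed.

Lemma oneform_eq_intro w z psi : (forall n, borel_partition (w n)) ->
  (forall n, borel_partition (z n)) -> integrable_borel nu psi ->
  (forall n, dominated_family nu (family_sub (w n) (z n))
     (fun x => (half n)%:E * psi x)%E) ->
  oneform_eq nu w z.
Proof.
move=> bw bz ipsi wz; have [[mpsi psi0] Ipsi] := ipsi.
have I0 : (0 <= \int[nu]_x psi x)%E by apply: integral_ge0.
have Ifin : (\int[nu]_x psi x)%E \is a fin_num by rewrite ge0_fin_numE.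
apply: (@squeeze_cvge _ _ _ _ (cst 0%E) _ (fun n => (half n)%:E * \int[nu]_x psi x)%E).
- apply/nearW => n; apply/andP; split.
    by apply: integral_ge0 => x _; exact: family_pnorm_ge0.
  rewrite -ge0_integralZl_EFin//.
  apply: family_norm_le => //; first exact: borel_partition_sub.
  by case: (integrable_borelZ (ltW (half_gt0 n)) ipsi).
- exact: cvg_cst.
- rewrite -(@fineK _ (\int[nu]_x psi x)%E)// -[X in _ --> X](mul0e (fine (\int[nu]_x psi x))%:E).
  apply: cvgeM => //; last exact: cvg_cst.
  by apply: cvg_EFin; [exact: nearW|exact: half_cvg0].
Qed.

Lemma Dnorm_eq_fun u v x : u =1 v -> Dnorm nu u x = Dnorm nu v x.
Proof. by move=> /funext ->. Qed.

Lemma L1cotangent_differential f : D11 nu f -> L1cotangent nu (differential f).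
Proof.
move=> df; apply: (@L1cotangent_intro _ (Dnorm nu f) (Dnorm nu f)).
- by move=> n; exact: borel_partition_differential.
- by move=> n [].
- exact: Dnorm_integrable_borel.
- by move=> n i; apply/aeW => x _.
- exact: Dnorm_integrable_borel.
- move=> m n i; have := Dnorm_cst nu 0; apply: ae_imp => x D0 _.
  rewrite (@Dnorm_eq_fun _ (cst 0)); last by move=> y /=; rewrite subrr.
  by rewrite D0 mule_ge0 ?Dnorm_ge0// lee_fin addr_ge0// ltW// half_gt0.
Qed.

Lemma dyadic_sub m n (y : R) (j k : int) :
  Num.floor (2 ^+ m * y) = j -> Num.floor (2 ^+ n * y) = k ->
  `|j%:~R / 2 ^+ m - k%:~R / 2 ^+ n| <= half m + half n.
Proof.
move=> <- <-; have := dyadic_floor m y; have := dyadic_floor n y.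
set a := _ / 2 ^+ n; set b := _ / 2 ^+ m => ha hb.
have -> : b - a = (b - y) - (a - y) by ring.
by rewrite (le_trans (ler_normB _ _))// lerD.
Qed.

Lemma dyadic_bound n (y M : R) (j : int) : Num.floor (2 ^+ n * y) = j ->
  `|y| <= M -> `|j%:~R / 2 ^+ n| <= M + 1.
Proof.
move=> <- yM; have := dyadic_floor n y; set b := _ / 2 ^+ n => hb.
have -> : b = y + (b - y) by ring.
by rewrite (le_trans (ler_normD _ _))// lerD// (le_trans hb)// half_le1.
Qed.

Lemma L1cotangent_scale h f (M : R) : measurable_fun [set: borel X] h ->
  (forall x, `|h x| <= M) -> D11 nu f ->
  L1cotangent nu (oneform_scale h (differential f)).
Proof.
move=> mh hM df.
have M0 : 0 <= M + 1.
  by rewrite addr_ge0// (le_trans (normr_ge0 _) (hM point)).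
apply: (@L1cotangent_intro _ (fun x => (M + 1)%:E * Dnorm nu f x)%E (Dnorm nu f)).
- move=> n; apply: borel_partition_scale => //.
  exact: borel_partition_differential.
- by move=> n [[] j] /=; exact: D11Z.
- by apply: integrable_borelZ => //; exact: Dnorm_integrable_borel.
- move=> n [[] j] /=; have := DnormZ (j%:~R / 2 ^+ n) df.
  apply: ae_imp => x H [_ jx]; apply: (le_trans H).
  by rewrite lee_wpmul2r ?Dnorm_ge0// lee_fin (dyadic_bound jx).
- exact: Dnorm_integrable_borel.
- move=> m n [[[] j] [[] k]] /=.
  have := DnormZ (j%:~R / 2 ^+ m - k%:~R / 2 ^+ n) df.
  apply: ae_imp => x H [[_ jx] [_ kx]].
  rewrite (Dnorm_eq_fun _ (_ : _ =1
    (fun y => (j%:~R / 2 ^+ m - k%:~R / 2 ^+ n) * f y))); last first.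
    by move=> y; rewrite mulrBl.
  apply: (le_trans H).
  by rewrite lee_wpmul2r ?Dnorm_ge0// lee_fin (dyadic_sub jx kx).
Qed.

Lemma Dnorm_combination (a b : R) f g : D11 nu f -> D11 nu g ->
  {ae nu, forall x, (Dnorm nu (fun y => (a * g y + b * f y)%R) x <=
     `|a|%:E * Dnorm nu g x + `|b|%:E * Dnorm nu f x)%E}.
Proof.
move=> df dg; have := DnormD (D11Z a dg) (D11Z b df).
have := DnormZ b df; have := DnormZ a dg; apply: ae_imp3 => x Ha Hb H.
by apply: (le_trans H); rewrite leeD.
Qed.

(** On a piece of the difference of the m-th and n-th families, both
    coefficients are differences of dyadic approximations of the same numbers. *)
Lemma L1cotangent_combination f g (Mf Mg : R) : D11 nu f -> D11 nu g ->
  (forall x, `|f x| <= Mf) -> (forall x, `|g x| <= Mg) ->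
  L1cotangent nu (oneform_add (oneform_scale f (differential g))
                              (oneform_scale g (differential f))).
Proof.
move=> df dg fM gM.
have M0 : 0 <= Mf + 1.
  by rewrite addr_ge0// (le_trans (normr_ge0 _) (fM point)).
have M0' : 0 <= Mg + 1.
  by rewrite addr_ge0// (le_trans (normr_ge0 _) (gM point)).
have iDf := Dnorm_integrable_borel nu f; have iDg := Dnorm_integrable_borel nu g.
apply: (@L1cotangent_intro _
  (fun x => (Mf + 1)%:E * Dnorm nu g x + (Mg + 1)%:E * Dnorm nu f x)%E
  (fun x => Dnorm nu g x + Dnorm nu f x)%E).
- move=> n; apply: borel_partition_add; apply: borel_partition_scale;
    first [exact: (D11_measurable df)|exact: (D11_measurable dg)|
      exact: borel_partition_differential].
- by move=> n [[[] j] [[] k]] /=; apply: D11D; exact: D11Z.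
- by apply: integrable_borelD; exact: integrable_borelZ.
- move=> n [[[] j] [[] k]] /=.
  have := Dnorm_combination (j%:~R / 2 ^+ n) (k%:~R / 2 ^+ n) df dg.
  apply: ae_imp => x H [[_ jx] [_ kx]]; apply: (le_trans H).
  by rewrite leeD// lee_wpmul2r ?Dnorm_ge0// lee_fin ?(dyadic_bound jx)// (dyadic_bound kx).
- exact: integrable_borelD.
- move=> m n [[[[] j] [[] k]] [[[] j'] [[] k']]] /=.
  have := Dnorm_combination (j%:~R / 2 ^+ m - j'%:~R / 2 ^+ n)
    (k%:~R / 2 ^+ m - k'%:~R / 2 ^+ n) df dg.
  apply: ae_imp => x H [[[_ jx] [_ kx]] [[_ jx'] [_ kx']]].
  rewrite (Dnorm_eq_fun _ (_ : _ =1 (fun y => (j%:~R / 2 ^+ m - j'%:~R / 2 ^+ n) * g y +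
     (k%:~R / 2 ^+ m - k'%:~R / 2 ^+ n) * f y))); last by move=> y; ring.
  apply: (le_trans H); rewrite ge0_muleDr ?Dnorm_ge0//.
  rewrite leeD// lee_wpmul2r ?Dnorm_ge0// lee_fin; first exact: (dyadic_sub jx jx').
  exact: (dyadic_sub kx kx').
Qed.

(** The pieces are the sets where [f] and [g] have given dyadic approximations
    [a] and [b], within [2^-n]; there [curvewise_leibniz] bounds the gradient of
    [f g - (a g + b f)] by [2^-n (|D g| + |D f|)]. *)
Lemma oneform_eq_leibniz f g (Mf Mg : R) : D11 nu f -> D11 nu g ->
  (forall x, `|f x| <= Mf) -> (forall x, `|g x| <= Mg) ->
  oneform_eq nu (differential (fun x => f x * g x))
    (oneform_add (oneform_scale f (differential g))
                 (oneform_scale g (differential f))).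
Proof.
move=> df dg fM gM.
apply: (@oneform_eq_intro _ _ (fun x => Dnorm nu g x + Dnorm nu f x)%E).
- by move=> n; exact: borel_partition_differential.
- move=> n; apply: borel_partition_add; apply: borel_partition_scale;
    first [exact: (D11_measurable df)|exact: (D11_measurable dg)|
      exact: borel_partition_differential].
- by apply: integrable_borelD; exact: Dnorm_integrable_borel.
move=> n [[] [[[] j] [[] k]]] /=.
have := Dnorm_ae_le (curvewise_leibniz (j%:~R / 2 ^+ n) (k%:~R / 2 ^+ n) df dg fM gM).
apply: ae_imp => x H [_ [[_ jx] [_ kx]]]; apply: (le_trans H).
rewrite ge0_muleDr ?Dnorm_ge0// leeD// lee_wpmul2r ?Dnorm_ge0// lee_fin distrC.
  by rewrite -jx; exact: dyadic_floor.
by rewrite -kx; exact: dyadic_floor.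
Qed.

Lemma L1cotangent_differentialD f g : D11 nu f -> D11 nu g ->
  L1cotangent nu (oneform_add (differential f) (differential g)).
Proof.
move=> df dg.
have iD : integrable_borel nu (fun x => Dnorm nu f x + Dnorm nu g x)%E.
  by apply: integrable_borelD; exact: Dnorm_integrable_borel.
apply: (L1cotangent_intro _ _ iD _ iD).
- by move=> n; apply: borel_partition_add; exact: borel_partition_differential.
- by move=> n [[] []] /=; exact: D11D.
- by move=> n [[] []] /=; have := DnormD df dg; apply: ae_imp.
- move=> m n [[[] []] [[] []]] /=; have := Dnorm_cst nu 0; apply: ae_imp => x D0 _.
  rewrite (@Dnorm_eq_fun _ (cst 0)); last by move=> y /=; rewrite subrr.
  by rewrite D0 mule_ge0 ?adde_ge0 ?Dnorm_ge0// lee_fin addr_ge0// ltW// half_gt0.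
Qed.

Lemma oneform_eq_differentialD f g : D11 nu f -> D11 nu g ->
  oneform_eq nu (differential (fun x => f x + g x))
    (oneform_add (differential f) (differential g)).
Proof.
move=> df dg.
apply: (@oneform_eq_intro _ _ (cst 0%E)).
- by move=> n; exact: borel_partition_differential.
- by move=> n; apply: borel_partition_add; exact: borel_partition_differential.
- exact: integrable_borel0.
move=> n [[] [[] []]] /=; have := Dnorm_cst nu 0; apply: ae_imp => x D0 _.
rewrite (@Dnorm_eq_fun _ (cst 0)); last by move=> y /=; rewrite subrr.
by rewrite D0 mule0.
Qed.

(** The dyadic approximations of the indicator are exact, so the sequence of
    norms is constant. *)
Lemma oneform_norm_restrict f (E : set X) : measurable (E : set (borel X)) ->
  D11 nu f ->
  (0 <= oneform_norm nu (oneform_scale (\1_E) (differential f)) <=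
   \int[nu]_(x in E) Dnorm nu f x)%E.
Proof.
move=> mE df.
have mE1 : measurable_fun [set: borel X] (\1_E : X -> R) by exact: measurable_indic.
pose N x := if x \in E then Dnorm nu f x else Dnorm nu (cst 0) x.
have pE n : family_norm nu (oneform_scale (\1_E) (differential f) n) = (\int[nu]_x N x)%E.
  apply: eq_integral => x _; rewrite /N.
  have bp : borel_partition (family_scale n (\1_E) (@differential R X f n)).
    by apply: borel_partition_scale => //; exact: borel_partition_differential.
  have p0 : 2 ^+ n != 0 :> R by rewrite expf_neq0.
  pose F := family_scale n (\1_E) (@differential R X f n).
  have [xE|xE] := boolP (x \in E).
    rewrite (@family_pnormE _ _ nu F (tt, (2 ^ n)%N%:Z) x bp).
      by apply: Dnorm_eq_fun => y /=; rewrite -pmulrn natrX divff// mul1r.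
    split => //=; rewrite indicE xE mulr1.
    apply: floor_def; rewrite intrD -pmulrn natrX lexx/=.
    by rewrite ltrDl ltr01.
  rewrite (@family_pnormE _ _ nu F (tt, 0) x bp).
    by apply: Dnorm_eq_fun => y /=; rewrite !mul0r.
  by split => //=; rewrite indicE (negbTE xE) mulr0 floor0.
rewrite /oneform_norm (_ : (fun n => _) = cst (\int[nu]_x N x)%E); last exact/funext.
rewrite lim_cst//; apply/andP; split.
  by apply: integral_ge0 => x _; rewrite /N; case: ifP => _; exact: Dnorm_ge0.
rewrite [leRHS]integral_mkcond.
have mD0 := measurable_Dnorm nu (cst 0); have mDf := measurable_Dnorm nu f.
apply: ae_ge0_le_integral => //.
- by move=> x _; rewrite /N; case: ifP => _; exact: Dnorm_ge0.
- by apply: measurable_fun_ifT => //; exact: measurable_mem.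
- by move=> x _; apply: erestrict_ge0 => y _; exact: Dnorm_ge0.
- by apply: (iffLR (measurable_restrictT _ _)) => //; exact: measurable_funTS.
have := Dnorm_cst nu 0; apply: ae_imp => x D0 _.
by rewrite /N patchE; case: ifP => // _; rewrite D0.
Qed.

End OneForms.

(** * Lebesgue spaces *)

Section LebesgueSpaces.
Context d (T : measurableType d) {R : realType}.
Context (mu : {measure set T -> \bar R}).
Implicit Types f g : T -> R.

Lemma LfunP_measurable (q : \bar R) f : f \in Lfun mu q ->
  measurable_fun setT f.
Proof. by rewrite inE => /andP[/[!inE]]. Qed.

Lemma Lfun_infty f (M : R) : measurable_fun setT f ->
  {ae mu, forall x, `|f x| <= M} -> f \in Lfun mu +oo%E.
Proof.
move=> mf fM; rewrite inE; apply/andP; split; rewrite inE//=.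
rewrite /finite_norm unlock; case: ifP => // _.
apply: (@le_lt_trans _ _ M%:E); last by rewrite ltry.
by apply/ess_supP; apply: filterS fM => x; rewrite /= lee_fin.
Qed.

Lemma Lfun_infty_bounded f : f \in Lfun mu +oo%E ->
  exists M : R, {ae mu, forall x, `|f x| <= M}.
Proof.
move=> ff; move: (ff); rewrite inE => /andP[_ /[!inE]/=].
rewrite /finite_norm unlock; case: ifPn => [_|].
  case E : (ess_sup mu (abse \o (EFin \o f))) => [r| |]// _.
    exists r; have := ess_sup_ge mu (abse \o (EFin \o f)); rewrite E.
    by apply: filterS => x; rewrite /= lee_fin.
  exists 0; have := ess_sup_ge mu (abse \o (EFin \o f)); rewrite E.
  by apply: filterS => x; rewrite /= leeNy_eq.
rewrite -leNgt => m0 _; exists 0; exists setT; split => //.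
by apply/eqP; rewrite eq_le m0 measure_ge0.
Qed.

Lemma Lfun_real (p : R) f : 1 <= p -> measurable_fun setT f ->
  (\int[mu]_x (`|f x| `^ p)%:E < +oo)%E -> f \in Lfun mu p%:E.
Proof.
move=> p1 mf fp; rewrite inE; apply/andP; split; rewrite inE//=.
rewrite /finite_norm unlock; apply: poweR_lty.
exact: fp.
Qed.

Lemma Lfun_integral_lty (p : R) f : 1 <= p -> f \in Lfun mu p%:E ->
  (\int[mu]_x (`|f x| `^ p)%:E < +oo)%E.
Proof.
move=> p1 /(Lfun_integrable p1)/integrableP[_]; apply: le_lt_trans.
rewrite le_eqVlt; apply/orP; left; apply/eqP; apply: eq_integral => x _.
by rewrite gee0_abs// lee_fin powR_ge0.
Qed.

Lemma measurable_powR_norm (p : R) f : measurable_fun setT f ->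
  measurable_fun setT (fun x => (`|f x| `^ p)%:E).
Proof.
move=> mf; apply/measurable_EFinP.
apply: (measurableT_comp (measurable_powR _)) => //.
exact: measurableT_comp.
Qed.

Lemma Lfun_le (q : \bar R) f g : (1 <= q)%E -> measurable_fun setT f ->
  (forall x, `|f x| <= `|g x|) -> g \in Lfun mu q -> f \in Lfun mu q.
Proof.
case: q => [q| |]//= q1 mf fg gq; last first.
  have [M gM] := Lfun_infty_bounded gq.
  by apply: (@Lfun_infty _ M) => //; apply: filterS gM => x; exact: le_trans.
apply: Lfun_real => //; apply: le_lt_trans (Lfun_integral_lty q1 gq).
apply: ge0_le_integral => //.
- exact: measurable_powR_norm.
- by apply: measurable_powR_norm; exact: LfunP_measurable gq.
- move=> x _; rewrite lee_fin ge0_ler_powR ?nnegrE//.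
  by rewrite (le_trans _ (_ : 1 <= q)).
Qed.

(** Interpolation: [|f|^p <= M^(p-1) |f|]. *)
Lemma Lfun1_bounded (p M : R) f : 1 <= p -> f \in Lfun mu 1%E ->
  {ae mu, forall x, `|f x| <= M} -> f \in Lfun mu p%:E.
Proof.
move=> p1 f1 fM; have mf := LfunP_measurable f1.
apply: Lfun_real => //.
have := (Lfun1_integrable mu f).1 f1 => /integrableP[_ fi].
apply: (@le_lt_trans _ _ (\int[mu]_x ((M `^ (p - 1))%:E * `|f x|%:E))%E).
  apply: ae_ge0_le_integral => //.
  - exact: measurable_powR_norm.
  - by move=> x _; rewrite -EFinM lee_fin mulr_ge0 ?powR_ge0.
  - by apply: measurable_funeM; apply/measurable_EFinP; exact: measurableT_comp.
  apply: filterS fM => x fM _; rewrite -EFinM lee_fin.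
  have [->|f0] := eqVneq (f x) 0.
    by rewrite normr0 mulr0 powR0// gt_eqF// (lt_le_trans ltr01).
  have -> : p = (p - 1) + 1 by rewrite subrK.
  rewrite powRD; last by rewrite normr_eq0 f0 implybT.
  rewrite powRr1// addrK ler_wpM2r// ge0_ler_powR ?nnegrE ?subr_ge0//.
  exact: le_trans fM.
rewrite ge0_integralZl_EFin ?powR_ge0//.
  by rewrite lte_mul_pinfty// lee_fin powR_ge0.
by apply/measurable_EFinP; exact: measurableT_comp.
Qed.

Lemma hoelder_conjugate_ge1 (p : R) (q : \bar R) : 1 <= p ->
  (p%:E^-1 + q^-1 = 1)%E -> (1 <= q)%E.
Proof.
move=> p1 /hoelder_conjugateP -> //; first exact: hoelder_conj_ge1.
  exact: ltNyr.
by rewrite eqe gt_eqF// (lt_le_trans ltr01).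
Qed.

(** Hoelder's inequality; for [p = 1] the other exponent is infinite. *)
Lemma Lfun_mul_integrable (p : R) (q : \bar R) f g : 1 <= p ->
  (p%:E^-1 + q^-1 = 1)%E -> f \in Lfun mu p%:E -> g \in Lfun mu q ->
  mu.-integrable setT (EFin \o (f \* g)).
Proof.
move=> p1 pq fp gq; have q1 := hoelder_conjugate_ge1 p1 pq.
have p0 : 0 < p := lt_le_trans ltr01 p1.
have mf := LfunP_measurable fp; have mg := LfunP_measurable gq.
have mfg : measurable_fun setT (f \* g) by exact: measurable_funM.
case: q pq gq q1 => [q| |]// pq gq q1.
  have q0 : 0 < q by rewrite -lte_fin (lt_le_trans _ q1)// lte_fin.
  apply/Lfun1_integrable; rewrite inE; apply/andP; split; rewrite inE//=.
  apply: le_lt_trans (hoelder mu mf mg p0 q0 _) _.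
    by apply: EFin_inj; rewrite EFinD -pq !inver !gt_eqF.
  move: fp gq; rewrite !inE => /andP[_ /[!inE]/= fn] /andP[_ /[!inE]/= gn].
  by rewrite lte_mul_pinfty ?Lnorm_ge0// ge0_fin_numE ?Lnorm_ge0.
have {}p1 : p = 1.
  move: pq; rewrite invey adde0 inver gt_eqF// => -[] /eqP.
  by rewrite invr_eq1 => /eqP.
move: fp; rewrite p1 => /Lfun1_integrable fi.
have [M gM] := Lfun_infty_bounded gq.
apply/integrableP; split; first exact/measurable_EFinP.
have /integrableP[_ fi'] := fi.
apply: (@le_lt_trans _ _ (\int[mu]_x (`|M|%:E * `|f x|%:E))%E).
  apply: ae_ge0_le_integral => //.
  - by apply: measurableT_comp => //; exact/measurable_EFinP.
  - by apply: measurable_funeM; apply/measurable_EFinP; exact: measurableT_comp.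
  apply: filterS gM => x gM _; rewrite /= -EFinM lee_fin normrM mulrC.
  by rewrite ler_wpM2r// (le_trans gM)// ler_norm.
rewrite ge0_integralZl_EFin//; first by rewrite lte_mul_pinfty.
by apply/measurable_EFinP; exact: measurableT_comp.
Qed.

End LebesgueSpaces.

(** * Tangent fields *)

Section TangentFields.
Context {R : realType} {X : completeMetricType R}.
Context (nu : {measure set (borel X) -> \bar R}).
Implicit Types (u v f g h eta : X -> R) (V : @oneform R X -> X -> R).

Lemma tangent_Lfun1 V f : Linf_tangent nu V -> D11 nu f ->
  V (differential f) \in Lfun nu 1%E.
Proof. by move=> [V1 _ _ _ _] df; apply: V1; exact: L1cotangent_differential. Qed.

Lemma tangent_measurable V f : Linf_tangent nu V -> D11 nu f ->
  measurable_fun [set: borel X] (V (differential f)).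
Proof. by move=> HV df; apply: LfunP_measurable (tangent_Lfun1 HV df). Qed.

(** Boundedness of [V] is an inequality between integrals.  Multiplying [df] by
    the indicator of the set [E] where the pointwise bound fails localizes it to
    [E], which must then be a null set. *)
Lemma tangent_bound V : Linf_tangent nu V -> exists2 C : R, 0 <= C &
  forall f, D11 nu f ->
  {ae nu, forall x, (`|V (differential f) x|%:E <= C%:E * Dnorm nu f x)%E}.
Proof.
move=> HV; have [V1 V2 V3 V4 [C VC]] := HV.
exists (Num.max C 0); first by rewrite le_max lexx orbT.
move=> f df; set K := Num.max C 0.
have K0 : 0 <= K by rewrite le_max lexx orbT.
have mVf := tangent_measurable HV df.
have iD := integrable_borelZ K0 (Dnorm_integrable_borel nu f).
have [[mKD KD0] _] := iD.
have mVn : measurable_fun [set: borel X] (fun x => `|V (differential f) x|%:E).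
  by apply/measurable_EFinP; exact: measurableT_comp.
have iV : integrable_borel nu (fun x => `|V (differential f) x|%:E).
  split; first by split.
  by have /Lfun1_integrable/integrableP[_] := tangent_Lfun1 HV df.
apply: le_ge0_integral_ae_le iV iD _.
pose E := [set x : borel X | (K%:E * Dnorm nu f x < `|V (differential f) x|%:E)%E].
have mE : measurable E.
  by rewrite -[E]setTI; exact: emeasurable_fun_lt.
have Ebound : (\int[nu]_(x in E) `|V (differential f) x|%:E <=
    \int[nu]_(x in E) (K%:E * Dnorm nu f x))%E.
  have L1s : L1cotangent nu (oneform_scale (\1_E) (differential f)).
    apply: (@L1cotangent_scale _ _ _ _ _ 1) => //.
    by move=> x; rewrite indicE; case: (_ \in _); rewrite ?normr1 ?normr0.
  have E1 : (\1_E : X -> R) \in Lfun nu +oo%E.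
    apply: (@Lfun_infty _ _ _ _ _ 1) => //; apply/aeW => x.
    by rewrite indicE; case: (_ \in _); rewrite ?normr1 ?normr0.
  have -> : (\int[nu]_(x in E) `|V (differential f) x|%:E =
      \int[nu]_x `|V (oneform_scale (\1_E) (differential f)) x|%:E)%E.
    rewrite integral_mkcond; apply: ge0_ae_eq_integral => //.
    - by apply: (iffLR (measurable_restrictT _ _)) => //; exact: measurable_funTS.
    - apply/measurable_EFinP; apply: measurableT_comp => //.
      by apply: LfunP_measurable (V1 _ L1s).
    - by move=> x _; apply: erestrict_ge0.
    have := V4 _ _ E1 (L1cotangent_differential df); apply: ae_imp => x H _.
    rewrite H patchE indicE; case: (x \in E); first by rewrite mul1r.
    by rewrite mul0r normr0.
  apply: (le_trans (VC _ L1s)).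
  rewrite ge0_integralZl_EFin//; last 2 first.
  - by move=> x _; exact: Dnorm_ge0.
  - by apply: measurable_funTS; exact: measurable_Dnorm.
  have /andP[n0 nE] := oneform_norm_restrict mE df.
  apply: (@le_trans _ _ (K%:E * oneform_norm nu (oneform_scale (\1_E) (differential f)))%E).
    by rewrite lee_wpmul2r// lee_fin le_max lexx.
  by rewrite lee_wpmul2l.
have KD0' x : (0 <= K%:E * Dnorm nu f x)%E by exact: KD0.
rewrite (ge0_integral_setUC nu mE)// [leRHS](ge0_integral_setUC nu mE)//; last 2 first.
- exact: measurable_mine.
- by move=> x; rewrite le_min lee_fin normr_ge0 KD0'.
(* the minimum of the two functions is the second one on E and the first one
off E *)
rewrite leeD//.
  apply: (le_trans Ebound); rewrite le_eqVlt; apply/orP; left; apply/eqP.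
  by apply: eq_integral => x; rewrite inE => Ex; rewrite minEle ifF//; apply: lt_geF.
rewrite le_eqVlt; apply/orP; left; apply/eqP.
apply: eq_integral => x; rewrite inE => Ex; rewrite minEle ifT//.
by rewrite leNgt; apply/negP.
Qed.

Lemma tangentD V f g : Linf_tangent nu V -> D11 nu f -> D11 nu g ->
  {ae nu, forall x, V (differential (fun y => f y + g y)) x =
    V (differential f) x + V (differential g) x}.
Proof.
move=> [V1 V2 V3 V4 _] df dg.
have := V3 _ _ (L1cotangent_differential df) (L1cotangent_differential dg).
have := V2 _ _ (L1cotangent_differential (D11D df dg))
  (L1cotangent_differentialD df dg) (oneform_eq_differentialD df dg).
by apply: ae_imp2 => x -> ->.
Qed.

Lemma tangent_leibniz V f g (Mf Mg : R) : Linf_tangent nu V ->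
  D11 nu f -> D11 nu g ->
  (forall x, `|f x| <= Mf) -> (forall x, `|g x| <= Mg) ->
  {ae nu, forall x, V (differential (fun y => f y * g y)) x =
    f x * V (differential g) x + g x * V (differential f) x}.
Proof.
move=> [V1 V2 V3 V4 _] df dg fM gM.
have fL : f \in Lfun nu +oo%E.
  by apply: (@Lfun_infty _ _ _ _ _ Mf); [exact: D11_measurable df|exact: aeW].
have gL : g \in Lfun nu +oo%E.
  by apply: (@Lfun_infty _ _ _ _ _ Mg); [exact: D11_measurable dg|exact: aeW].
have Lf := L1cotangent_differential df; have Lg := L1cotangent_differential dg.
have E1 := V2 _ _ (L1cotangent_differential (D11M df dg fM gM))
  (L1cotangent_combination df dg fM gM) (oneform_eq_leibniz df dg fM gM).
have E2 := V3 _ _ (L1cotangent_scale (D11_measurable df) fM dg)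
  (L1cotangent_scale (D11_measurable dg) gM df).
have := V4 _ _ gL Lf; have := V4 _ _ fL Lg.
have : {ae nu, forall x, V (differential (fun y => f y * g y)) x =
    V (oneform_scale f (differential g)) x + V (oneform_scale g (differential f)) x}.
  by move: E1 E2; apply: ae_imp2 => x -> ->.
by apply: ae_imp3 => x -> -> ->.
Qed.

Lemma Lfun_mul_bounded (p : \bar R) f g (M : R) : (1 <= p)%E ->
  measurable_fun [set: borel X] f -> (forall x, `|f x| <= M) ->
  g \in Lfun nu p -> (fun x => f x * g x) \in Lfun nu p.
Proof.
move=> p1 mf fM gp; have M0 : 0 <= M := le_trans (normr_ge0 _) (fM point).
have mg := LfunP_measurable gp.
have Mg : (fun x => M * g x) \in Lfun nu p.
  have [_ Z] := (@Lfun_submod_closed _ _ _ nu p p1).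
  have := Z M g 0 gp; rewrite (_ : M *: g + 0 = (fun x => M * g x)); last first.
    by apply/funext => x; rewrite addr0.
  by apply; case: (@Lfun_addr_closed _ _ _ nu p p1).
apply: (Lfun_le p1 _ _ Mg); first exact: measurable_funM.
move=> x; rewrite !normrM; apply: ler_wpM2r => //.
by rewrite (le_trans (fM x))// ler_norm.
Qed.

Lemma Linf_tangent_scale V eta (M : R) : measurable_fun [set: borel X] eta ->
  (forall x, `|eta x| <= M) -> Linf_tangent nu V ->
  Linf_tangent nu (field_scale eta V).
Proof.
move=> meta etaM [V1 V2 V3 V4 [C VC]].
have M0 : 0 <= M := le_trans (normr_ge0 _) (etaM point).
split.
- by move=> w /V1; exact: Lfun_mul_bounded.
- move=> w z Lw Lz wz; have := V2 _ _ Lw Lz wz; apply: ae_imp => x.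
  by rewrite /field_scale => ->.
- move=> w z Lw Lz; have := V3 _ _ Lw Lz; apply: ae_imp => x.
  by rewrite /field_scale => ->; rewrite mulrDr.
- move=> h w hL Lw; have := V4 _ _ hL Lw; apply: ae_imp => x.
  by rewrite /field_scale => ->; rewrite mulrCA.
exists (M * C) => w Lw; rewrite /field_scale.
have mVw := LfunP_measurable (V1 _ Lw).
apply: (@le_trans _ _ (\int[nu]_x (M%:E * `|V w x|%:E))%E).
  apply: ge0_le_integral => //.
  - apply/measurable_EFinP; apply: measurableT_comp => //; exact: measurable_funM.
  - by apply: measurable_funeM; apply/measurable_EFinP; exact: measurableT_comp.
  - by move=> x _; rewrite -EFinM lee_fin normrM ler_wpM2r.
rewrite ge0_integralZl_EFin//; last first.
  by apply/measurable_EFinP; exact: measurableT_comp.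
by rewrite EFinM -muleA lee_wpmul2l//; exact: VC.
Qed.

End TangentFields.

(** * The divergence of a product *)

Section DivergenceOfProduct.
Context {R : realType} {X : completeMetricType R}.
Context (nu : {measure set (borel X) -> \bar R}).
Implicit Types (u v f g h eta : X -> R) (V : @oneform R X -> X -> R).

Lemma LfunD (p : \bar R) f g : (1 <= p)%E -> f \in Lfun nu p ->
  g \in Lfun nu p -> (fun x => f x + g x) \in Lfun nu p.
Proof. by move=> p1 fp gp; case: (Lfun_addr_closed nu p1) => _ /(_ f g fp gp). Qed.

Lemma ae_eq_Rintegral f g : measurable_fun [set: borel X] f ->
  measurable_fun [set: borel X] g -> {ae nu, forall x, f x = g x} ->
  \int[nu]_x f x = \int[nu]_x g x.
Proof.
move=> mf mg fg; congr fine; apply: ae_eq_integral => //; try exact/measurable_EFinP.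
by move: fg; apply: ae_imp => x -> _.
Qed.

Lemma norm_Rintegral_le f : f \in Lfun nu 1%E ->
  (`|\int[nu]_x f x|%:E <= \int[nu]_x `|f x|%:E)%E.
Proof.
move=> /Lfun1_integrable fi.
have := le_normr_Rintegral measurableT fi; rewrite -lee_fin; move=> /le_trans; apply.
rewrite /Rintegral fineK//; exact: integrable_fin_num (integrable_norm fi).
Qed.

Lemma Lfun1_RintegralD f g : f \in Lfun nu 1%E -> g \in Lfun nu 1%E ->
  \int[nu]_x (f x + g x) = \int[nu]_x f x + \int[nu]_x g x.
Proof. by move=> /Lfun1_integrable fi /Lfun1_integrable gi; exact: RintegralD. Qed.

(** Test [div X] against [eta g] and expand [d(eta g)] by the Leibniz rule; the
    bound on [g] makes [g] an admissible coefficient of the one-form [deta]. *)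
Lemma has_divergence_scale_bounded p q V divV eta g (M N : R) :
  1 <= p -> (p%:E^-1 + q^-1 = 1)%E -> has_divergence nu p%:E q V divV ->
  D11 nu eta -> (forall x, `|eta x| <= M) -> W11 nu g -> g \in Lfun nu q ->
  (forall x, `|g x| <= N) ->
  \int[nu]_x ((V (differential eta) x + eta x * divV x) * g x) +
  \int[nu]_x (eta x * V (differential g) x) = 0.
Proof.
move=> p1 pq [HV Dp Hdiv] deta etaM [dg g1] gq gN.
have q1 := hoelder_conjugate_ge1 p1 pq.
have meta := D11_measurable deta; have mg := D11_measurable dg.
have mVe := tangent_measurable HV deta; have mVg := tangent_measurable HV dg.
have Ve1 := tangent_Lfun1 HV deta; have Vg1 := tangent_Lfun1 HV dg.
have eg1 : (fun x => eta x * g x) \in Lfun nu 1%E by exact: Lfun_mul_bounded etaM g1.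
have egq : (fun x => eta x * g x) \in Lfun nu q by exact: Lfun_mul_bounded etaM gq.
have deg := D11M deta dg etaM gN.
have H := Hdiv _ (conj deg eg1) egq.
have mdiv := LfunP_measurable Dp.
have i1 : (fun x => g x * V (differential eta) x) \in Lfun nu 1%E.
  exact: Lfun_mul_bounded gN Ve1.
have i2 : (fun x => eta x * V (differential g) x) \in Lfun nu 1%E.
  exact: Lfun_mul_bounded etaM Vg1.
have i3 : (fun x => divV x * (eta x * g x)) \in Lfun nu 1%E.
  exact/Lfun1_integrable/(Lfun_mul_integrable p1 pq).
have e1 : \int[nu]_x V (differential (fun y => eta y * g y)) x =
    \int[nu]_x (eta x * V (differential g) x) +
    \int[nu]_x (g x * V (differential eta) x).
  rewrite -Lfun1_RintegralD//; apply: ae_eq_Rintegral.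
  - exact: tangent_measurable HV deg.
  - by apply: measurable_funD; exact: measurable_funM.
  - exact: tangent_leibniz HV deta dg etaM gN.
have e2 : \int[nu]_x ((V (differential eta) x + eta x * divV x) * g x) =
    \int[nu]_x (g x * V (differential eta) x) + \int[nu]_x (divV x * (eta x * g x)).
  rewrite -Lfun1_RintegralD//; congr fine; apply: eq_integral => x _.
  by congr _%:E; ring.
by rewrite e2 H e1; ring.
Qed.

(** For unbounded [g] write [g] as its truncation at height [n] plus a tail.
    The truncations satisfy the identity by the bounded case.  The tails
    contribute at most the integral of [|D| |tail|] and a multiple of the
    integral of [|D g|] over the set where [|g| > n - 1], by locality; both tend
    to 0. *)
Lemma has_divergence_scale (p : R) q V divV eta (M L : R) :
  1 <= p -> (p%:E^-1 + q^-1 = 1)%E -> has_divergence nu p%:E q V divV ->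
  D11 nu eta -> (forall x, `|eta x| <= M) ->
  {ae nu, forall x, (Dnorm nu eta x <= L%:E)%E} ->
  has_divergence nu p%:E q (field_scale eta V)
    (fun x => V (differential eta) x + eta x * divV x).
Proof.
move=> p1 pq Hd deta etaM etaL; have [HV Dp Hdiv] := Hd.
have q1 := hoelder_conjugate_ge1 p1 pq.
have meta := D11_measurable deta.
have M0 : 0 <= M := le_trans (normr_ge0 _) (etaM point).
have [C C0 VC] := tangent_bound HV.
have DLp : (fun x => V (differential eta) x + eta x * divV x) \in Lfun nu p%:E.
  apply: LfunD => //; last by exact: Lfun_mul_bounded etaM Dp.
  apply: (@Lfun1_bounded _ _ _ _ _ (C * L)) => //; first exact: tangent_Lfun1.
  have := VC _ deta; move: etaL; apply: ae_imp2 => x xL Vx.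
  by rewrite -lee_fin (le_trans Vx)// EFinM lee_wpmul2l.
split => //; first exact: Linf_tangent_scale etaM HV.
move=> g [dg g1] gq; rewrite /field_scale; apply/eqP; rewrite -addr_eq0 -normr_le0.
set D := (fun x => V (differential eta) x + _) in DLp *.
pose gn (n : nat) x := clamp n%:R (g x).
pose tn (n : nat) x := g x - clamp n%:R (g x).
have n0 n : 0 <= n%:R :> R by [].
have mg := D11_measurable dg.
have dgn n : D11 nu (gn n).
  by apply: (@D11_lip _ _ nu g (clamp n%:R) 1) => // a b; rewrite mul1r clamp_lip.
have dtn n : D11 nu (tn n) by exact: D11B dg (dgn n).
have gng n x : `|gn n x| <= `|g x|.
  have := clamp_lip n%:R (g x) 0; rewrite [clamp n%:R 0]clamp_id ?normr0//.
  by rewrite !subr0.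
have tng n x : `|tn n x| <= `|g x|.
  have := tail_lip n%:R (g x) 0; rewrite [clamp n%:R 0]clamp_id ?normr0//.
  by rewrite !subr0.
have gnq n : gn n \in Lfun nu q.
  exact: Lfun_le q1 (D11_measurable (dgn n)) (gng n) gq.
have gn1 n : gn n \in Lfun nu 1%E.
  exact: Lfun_le (lexx _) (D11_measurable (dgn n)) (gng n) g1.
have tnq n : tn n \in Lfun nu q.
  exact: Lfun_le q1 (D11_measurable (dtn n)) (tng n) gq.
have Hn n := has_divergence_scale_bounded p1 pq Hd deta etaM
  (conj (dgn n) (gn1 n)) (gnq n) (fun x => clamp_bound (g x) (n0 n)).
have iD h : h \in Lfun nu q -> (fun x => D x * h x) \in Lfun nu 1%E.
  by move=> hq; exact/Lfun1_integrable/(Lfun_mul_integrable p1 pq).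
have iV h : D11 nu h -> (fun x => eta x * V (differential h) x) \in Lfun nu 1%E.
  by move=> dh; exact: Lfun_mul_bounded etaM (tangent_Lfun1 HV dh).
have e1 n : \int[nu]_x (D x * g x) + \int[nu]_x (eta x * V (differential g) x) =
   \int[nu]_x (D x * tn n x) + \int[nu]_x (eta x * V (differential (tn n)) x).
  have a1 : \int[nu]_x (D x * g x) =
      \int[nu]_x (D x * gn n x) + \int[nu]_x (D x * tn n x).
    rewrite -Lfun1_RintegralD ?iD//; congr fine; apply: eq_integral => x _.
    by rewrite -mulrDr /tn addrC subrK.
  have a2 : \int[nu]_x (eta x * V (differential g) x) =
      \int[nu]_x (eta x * V (differential (gn n)) x) +
      \int[nu]_x (eta x * V (differential (tn n)) x).
    rewrite -Lfun1_RintegralD ?iV//; apply: ae_eq_Rintegral.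
    - exact: LfunP_measurable (iV _ dg).
    - by apply: LfunP_measurable (LfunD _ (iV _ (dgn n)) (iV _ (dtn n))).
    have := tangentD HV (dgn n) (dtn n); apply: ae_imp => x.
    rewrite (_ : (fun y => gn n y + tn n y) = g); first by move=> ->; rewrite mulrDr.
    by apply/funext => y; rewrite /tn addrC subrK.
  by rewrite a1 a2 addrACA Hn add0r.
pose A n := (\int[nu]_x `|D x * tn n x|%:E)%E.
pose B n := (\int[nu]_x (Dnorm nu g \_ [set x | (n%:R - 1 < `|g x|)%R]) x)%E.
have Bn n : (\int[nu]_x `|eta x * V (differential (tn n)) x|%:E <= (M * C)%:E * B n)%E.
  have mU : measurable [set x : borel X | n%:R - 1 < `|g x|].
    rewrite -[X in measurable X]setTI; apply: measurable_fun_ltr => //.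
    exact: measurableT_comp.
  have mDU : measurable_fun [set: borel X] (Dnorm nu g \_ [set x | n%:R - 1 < `|g x|]).
    apply: (iffLR (measurable_restrictT _ _)) => //.
    by apply: measurable_funTS; exact: measurable_Dnorm.
  have DU0 x : (0 <= (Dnorm nu g \_ [set x | (n%:R - 1 < `|g x|)%R]) x)%E.
    by apply: erestrict_ge0 => y _; exact: Dnorm_ge0.
  rewrite -ge0_integralZl_EFin//; last exact: mulr_ge0.
  apply: ae_ge0_le_integral => //.
  - apply/measurable_EFinP; apply: measurableT_comp => //.
    exact: LfunP_measurable (iV _ (dtn n)).
  - by move=> x _; rewrite mule_ge0// lee_fin mulr_ge0.
  - exact: measurable_funeM.
  have T0 (a : R) : `|a| <= n%:R -> a - clamp n%:R a = 0.
    by move=> an; rewrite clamp_id// subrr.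
  have Dt := Dnorm_ae_le (curvewise_truncation mg (D11_Dnorm dg) (tail_lip n%:R) T0).
  have := VC _ (dtn n); move: Dt; apply: ae_imp2 => x Dx Vx _.
  rewrite normrM !EFinM -muleA; apply: lee_pmul => //; first by rewrite lee_fin.
  by apply: (le_trans Vx); rewrite lee_wpmul2l.
have le n : (`|\int[nu]_x (D x * g x) + \int[nu]_x (eta x * V (differential g) x)|%:E
    <= A n + (M * C)%:E * B n)%E.
  rewrite (e1 n); apply: (@le_trans _ _ (`|\int[nu]_x (D x * tn n x)|%:E +
     `|\int[nu]_x (eta x * V (differential (tn n)) x)|%:E)%E).
    by rewrite -EFinD lee_fin ler_normD.
  rewrite leeD//; first exact: norm_Rintegral_le (iD _ (tnq n)).
  by apply: le_trans (Bn n); exact: norm_Rintegral_le (iV _ (dtn n)).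
have large x : \forall n \near \oo, `|g x| <= n%:R - 1.
  near=> n; rewrite lerBrDr; near: n; exact: nbhs_infty_ger.
have cA : A @ \oo --> 0%E.
  have mD := LfunP_measurable DLp.
  have iDg : nu.-integrable setT (fun x => `|D x * g x|%:E).
    exact/integrable_norm/Lfun1_integrable/iD.
  have mt n : measurable_fun [set: borel X] (tn n) by exact: D11_measurable.
  have [|||||_ _] := @dominated_convergence _ _ _ nu setT measurableT
      (fun n x => `|D x * tn n x|%:E) (cst 0%E) (fun x => `|D x * g x|%:E).
  - move=> n; apply/measurable_EFinP; apply: measurableT_comp => //.
    exact: measurable_funM.
  - exact: measurable_cst.
  - apply: aeW => x _; apply: cvg_near_cst; have := large x; apply: filterS => n gx.
    rewrite /tn clamp_id ?subrr ?mulr0 ?normr0//.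
    by rewrite (le_trans gx)// lerBlDr lerDl.
  - exact: iDg.
  - apply: aeW => x n _; rewrite gee0_abs// lee_fin !normrM.
    by rewrite ler_wpM2l// tng.
  by rewrite integral0.
have cB : B @ \oo --> 0%E.
  have [_ iDn] := Dnorm_integrable_borel nu g.
  have [|||||_ _] := @dominated_convergence _ _ _ nu setT measurableT
    (fun n => Dnorm nu g \_ [set x | n%:R - 1 < `|g x|]) (cst 0%E) (Dnorm nu g).
  - move=> n; apply: (iffLR (measurable_restrictT _ _)).
      rewrite -[X in measurable X]setTI; apply: measurable_fun_ltr => //.
      exact: measurableT_comp.
    by apply: measurable_funTS; exact: measurable_Dnorm.
  - exact: measurable_cst.
  - apply: aeW => x _; apply: cvg_near_cst; have := large x; apply: filterS => n gx.
    by rewrite patchE memNset//=; apply/negP; rewrite -leNgt.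
  - apply/integrableP; split; first exact: measurable_Dnorm.
    by under eq_integral do rewrite gee0_abs ?Dnorm_ge0//.
  - apply: aeW => x n _; rewrite gee0_abs; last first.
      by apply: erestrict_ge0 => y _; exact: Dnorm_ge0.
    by rewrite patchE; case: ifP => // _; exact: Dnorm_ge0.
  by rewrite integral0.
have cAB : (fun n => A n + (M * C)%:E * B n)%E @ \oo --> 0%E.
  rewrite -[X in _ --> X]adde0 -[X in _ --> (_ + X)%E](mule0 (M * C)%:E).
  apply: cvgeD => //; apply: cvgeM => //; exact: cvg_cst.
rewrite -lee_fin.
apply: (closed_cvg (fun y => (`|\int[nu]_x (D x * g x) +
  \int[nu]_x (eta x * V (differential g) x)|%:E <= y)%E)) cAB => //.
  exact: closed_ereal_le_ereal.
exact: nearW.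
Unshelve. all: by end_near. Qed.

End DivergenceOfProduct.

(** * Doubling spaces are proper *)

Section DoublingSpaces.
Context {R : realType} {X : completeMetricType R}.
Context (nu : {measure set (borel X) -> \bar R}).
Context (dbl : doubling nu).

Lemma ball_lty (x : X) (r : R) : (nu (ball x r) < +oo)%E.
Proof.
have [r0|r0] := ltP 0 r; last first.
  rewrite (_ : ball x r = set0) ?measure0//; apply/seteqP; split => // y.
  by rewrite ballEmdist/= ltNge => /negP; apply; rewrite (le_trans r0)// mdist_ge0.
have [C C1 H] := dbl; have [_ _] := H x r r0; apply: le_lt_trans.
by rewrite -[leLHS]mul1e lee_wpmul2r// lee_fin.
Qed.

Lemma ball_gt0 (x : X) (r : R) : 0 < r -> (0 < nu (ball x r))%E.
Proof.
move=> r0; have [C C1 H] := dbl; have [+ _ _] := H x (r / 2) (divr_gt0 r0 (ltr0Sn _ 1)).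
by rewrite mulrC divfK.
Qed.

Lemma ball_ge_iter (C : R) : 0 < C ->
  (forall (x : X) (r : R), 0 < r -> (nu (ball x (2 * r)) <= C%:E * nu (ball x r))%E) ->
  forall m (x : X) (r : R), 0 < r ->
  (nu (ball x (2 ^+ m * r)) <= (C ^+ m)%:E * nu (ball x r))%E.
Proof.
move=> C0 H; elim=> [|m IH] x r r0; first by rewrite !expr0 mul1r mul1e.
rewrite exprS -mulrA (le_trans (H _ _ _)) ?mulr_gt0 ?exprn_gt0//.
by rewrite exprS EFinM -muleA lee_wpmul2l ?lee_fin ?(ltW C0)// IH.
Qed.

(** Otherwise there are infinitely many [e]-separated points in the ball.  The
    balls of radius [e / 2] around them are disjoint, contained in a ball of
    finite mass, and by iterated doubling their masses are bounded below. *)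
Lemma totally_bounded_ball (x0 : X) (r e : R) : 0 < r -> 0 < e ->
  exists s : seq X, forall x, ball x0 r x -> exists2 y, y \in s & ball y e x.
Proof.
move=> r0 e0; apply: contrapT => /forallNP nocover.
have /choice[nx Hnx] : forall s : seq X, exists x, ball x0 r x /\
    forall y, y \in s -> ~ ball y e x.
  move=> s; have /existsNP[x /not_implyP[xr H]] := nocover s.
  by exists x; split => // y ys yx; apply: H; exists y.
(* L n lists the first n points, and y n is the next one *)
pose L := fix L n : seq X := if n is n'.+1 then nx (L n') :: L n' else [::].
pose y n := nx (L n).
have yr n : ball x0 r (y n) by case: (Hnx (L n)).
have yL i j : (i < j)%N -> y i \in L j.
  elim: j => // j IH; rewrite ltnS leq_eqVlt => /predU1P[->|/IH].
    by rewrite /= inE eqxx.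
  by rewrite /= inE => ->; rewrite orbT.
have sep i j : (i < j)%N -> e <= mdist (y i) (y j).
  move=> /yL yi; have [_ /(_ _ yi)] := Hnx (L j).
  by rewrite ballEmdist/= => /negP; rewrite -leNgt.
pose B n : set (borel X) := ball (y n) (e / 2).
have mB n : measurable (B n) by exact: ball_borel.
have e20 : 0 < e / 2 by rewrite divr_gt0.
have tB : trivIset setT B.
  apply/trivIsetP => i j _ _ ij.
  wlog lij : i j ij / (i < j)%N.
    move=> H; move: (ij); rewrite neq_ltn => /orP[|] lt; first exact: H.
    by rewrite setIC; apply: H; rewrite 1?eq_sym.
  apply/seteqP; split => // z [].
  rewrite /B !ballEmdist/= => iz jz; have := sep _ _ lij.
  have := metric_triangle (y i) z (y j); rewrite [mdist z _]metric_sym; lra.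
have BX n : B n `<=` ball x0 (r + e).
  move=> z; rewrite /B !ballEmdist/= => yz; have := yr n; rewrite ballEmdist/= => xy.
  have := metric_triangle x0 (y n) z; lra.
have [C C1 HC] := dbl; have C0 : 0 < C by exact: lt_le_trans C1.
have [m mr] : exists m, 2 * r <= 2 ^+ m * (e / 2).
  have [m Hm] : exists m : nat, 2 * r / (e / 2) <= m%:R.
    exists (Num.bound (2 * r / (e / 2))).
    by apply/ltW/archi_boundP; rewrite divr_ge0 ?mulr_ge0// ltW.
  exists m; rewrite -ler_pdivrMr// (le_trans Hm)// -natrX ler_nat ltnW//.
  exact: ltn_expl.
pose delta := fine (nu (ball x0 r)) / C ^+ m.
have nr_fin : nu (ball x0 r) \is a fin_num by rewrite ge0_fin_numE ?ball_lty.
have d0 : 0 < delta.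
  by rewrite divr_gt0 ?exprn_gt0// fine_gt0// ball_gt0// ball_lty.
have Bd n : (delta%:E <= nu (B n))%E.
  have h1 : (nu (ball x0 r) <= nu (ball (y n) (2 ^+ m * (e / 2))))%E.
    apply: le_measure; rewrite ?inE; [exact: ball_borel|exact: ball_borel|].
    move=> z; rewrite !ballEmdist/= => xz; have := yr n; rewrite ballEmdist/= => xy.
    have := metric_triangle (y n) x0 z; rewrite [mdist (y n) x0]metric_sym; lra.
  have h2 : (nu (ball (y n) (2 ^+ m * (e / 2))) <= (C ^+ m)%:E * nu (B n))%E.
    by apply: ball_ge_iter => // x s s0; case: (HC x s s0).
  have Bfin : nu (B n) \is a fin_num by rewrite ge0_fin_numE ?ball_lty.
  have := le_trans h1 h2.
  rewrite -(fineK nr_fin) -(fineK Bfin) -EFinM !lee_fin /delta => h.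
  by rewrite ler_pdivrMr ?exprn_gt0// mulrC.
pose K := fine (nu (ball x0 (r + e))).
have Kfin : nu (ball x0 (r + e)) \is a fin_num by rewrite ge0_fin_numE ?ball_lty.
have NK (N : nat) : N%:R * delta <= K.
  rewrite -lee_fin /K fineK//.
  apply: (@le_trans _ _ (nu (\big[setU/set0]_(i < N) B i))).
    rewrite measure_bigsetU//.
    apply: (@le_trans _ _ (\sum_(i < N) delta%:E)%E); last by apply: lee_sum => i _; exact: Bd.
    by rewrite sumEFin sumr_const card_ord mulr_natl.
  apply: le_measure; rewrite ?inE; [exact: bigsetU_measurable|exact: ball_borel|].
  by rewrite -bigcup_mkord => z [i _]; exact: BX.
have := NK (Num.bound (K / delta)).
rewrite -ler_pdivlMr// leNgt => /negP; apply.
by apply: archi_boundP; rewrite divr_ge0 ?fine_ge0// ltW.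
Qed.

(** An ultrafilter on a totally bounded set contains balls of every radius, so
    it is Cauchy. *)
Lemma closed_in_ball_compact (A : set X) (x0 : X) (r : R) : 0 < r ->
  closed A -> A `<=` ball x0 r -> compact A.
Proof.
move=> r0 cA Ar; rewrite compact_ultra => F UF FA.
have FF : ProperFilter F by exact: ultra_proper.
have : cauchy_ex F.
  move=> e e0; apply: contrapT => /forallNP nF.
  have [s Hs] := totally_bounded_ball x0 r0 e0.
  have : F [set x | forall y, y \in s -> ~ ball y e x].
    elim: s {Hs} => [|y s IH].
      by apply: filterS filterT => x _ y; rewrite in_nil.
    have [//|Fy] := in_ultra_setVsetC (ball y e) UF; first by move/nF.
    move: IH Fy; apply: filterS2 => x xs xy z; rewrite inE => /predU1P[->//|].
    exact: xs.
  move=> /(filterI FA)/filter_ex[x [/Ar/Hs[y ys yx] /(_ _ ys)]].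
  by apply.
move=> /cauchy_exP/cauchy_cvg Fl; exists (lim F); split => //.
apply: cA => B /Fl FB; exact: filter_ex (filterI FA FB).
Qed.

End DoublingSpaces.

(** * Cutoff functions *)

Section Cutoffs.
Context {R : realType} {X : completeMetricType R}.

Definition cutoff (n : nat) (x : X) : R :=
  Num.max 0 (Num.min 1 (2 - mdist (point : X) x / n.+1%:R)).

Lemma cutoff_ge0 n x : 0 <= cutoff n x.
Proof. by rewrite /cutoff le_max lexx. Qed.

Lemma cutoff_le1 n x : cutoff n x <= 1.
Proof. by rewrite /cutoff ge_max ler01/= ge_min lexx. Qed.

Lemma cutoff_eq0 n x : 2 * n.+1%:R <= mdist (point : X) x -> cutoff n x = 0.
Proof.
move=> h; rewrite /cutoff.
have : 2 <= mdist point x / n.+1%:R by rewrite ler_pdivlMr.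
set a := _ / _ => ha; case: (leP 1 (2 - a)) => ?; case: (leP 0 (2 - a)) => ?;
  by case: (leP (0 : R) 1) => ?; lra.
Qed.

Lemma cutoff_eq1 n x : mdist (point : X) x <= n.+1%:R -> cutoff n x = 1.
Proof.
move=> h; rewrite /cutoff.
have : mdist point x / n.+1%:R <= 1 by rewrite ler_pdivrMr// mul1r.
set a := _ / _ => ha; case: (leP 1 (2 - a)) => ?; case: (leP 0 (2 - a)) => ?;
  by case: (leP (0 : R) 1) => ?; lra.
Qed.

Lemma cutoff_lip n x y : `|cutoff n x - cutoff n y| <= n.+1%:R^-1 * mdist x y.
Proof.
have n0 : 0 < n.+1%:R :> R by [].
have F (a b : R) : `|Num.max 0 (Num.min 1 a) - Num.max 0 (Num.min 1 b)| <= `|a - b|.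
  wlog ab : a b / a <= b.
    by move=> H; have [/H//|/ltW/H] := leP a b; rewrite distrC [leRHS]distrC.
  rewrite distrC [leRHS]distrC [leRHS]ger0_norm ?subr_ge0//.
  case: (leP 1 a) => ?; case: (leP 1 b) => ?; case: (leP 0 a) => ?;
    case: (leP 0 b) => ?; case: (leP (0 : R) 1) => ?; rewrite ?ger0_norm; lra.
apply: (le_trans (F _ _)); rewrite opprD addrACA subrr add0r -opprD.
rewrite normrN -mulrBl normrM [X in _ * X]gtr0_norm ?invr_gt0// mulrC.
rewrite ler_wpM2l ?invr_ge0// ler_norml.
have := metric_triangle point x y; have := metric_triangle point y x.
by rewrite [mdist y x]metric_sym => ? ?; apply/andP; split; lra.
Qed.

Lemma cutoff_cvg x : cutoff ^~ x @ \oo --> (1 : R).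
Proof.
apply: cvg_near_cst; near=> n; apply: cutoff_eq1.
apply: (@le_trans _ _ n%:R); last by rewrite ler_nat.
by near: n; exact: nbhs_infty_ger.
Unshelve. all: by end_near. Qed.

Context (nu : {measure set (borel X) -> \bar R}).
Context (dbl : doubling nu).

Lemma cutoff_compact n : compactly_supported (cutoff n).
Proof.
apply: (@closed_in_ball_compact _ _ nu dbl _ point (3 * n.+1%:R)) => //.
  exact: closed_closure.
move=> x /(_ _ (nbhsx_ballx x n.+1%:R (ltr0Sn _ _)))[y [y0]].
rewrite !ballEmdist/= => xy.
have yn : mdist point y < 2 * n.+1%:R.
  by rewrite ltNge; apply/negP => /cutoff_eq0 yE; move/eqP: y0.
have := metric_triangle point y x; rewrite [mdist y x]metric_sym; lra.
Qed.

Lemma curvewise_cutoff n :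
  curvewise_gradient nu (cutoff n)
    (fun x => n.+1%:R^-1%:E * (\1_(ball (point : X) (3 * n.+1%:R)) x)%:E)%E.
Proof.
have n0 : 0 < n.+1%:R :> R by [].
apply: (@curvewise_lipschitz_ball _ _ _ _ _ _ (2 * n.+1%:R)) => //.
- exact: cutoff_lip.
- by move=> x; exact: cutoff_eq0.
- by rewrite ltr_pM2r// ltr_nat.
- exact: ball_lty.
Qed.

Lemma D11_cutoff n : D11 nu (cutoff n).
Proof.
apply/D11_curvewise; split; last by eexists; exact: curvewise_cutoff.
exact: lipschitz_measurable (cutoff_lip n).
Qed.

Lemma Dnorm_cutoff n :
  {ae nu, forall x, (Dnorm nu (cutoff n) x <= n.+1%:R^-1%:E)%E}.
Proof.
have := Dnorm_ae_le (curvewise_cutoff n); apply: ae_imp => x H; apply: (le_trans H).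
by rewrite -EFinM lee_fin indicE; case: (_ \in _); rewrite ?mulr1// mulr0 invr_ge0.
Qed.

End Cutoffs.

(** * The integration by parts formula *)

Lemma Rintegral_dominated_cvg d (T : measurableType d) (R : realType)
    (mu : {measure set T -> \bar R}) (f_ : nat -> T -> R) (f : T -> R)
    (g : T -> \bar R) :
  (forall n, measurable_fun setT (f_ n)) -> measurable_fun setT f ->
  (forall x, f_ ^~ x @ \oo --> f x) -> mu.-integrable setT g ->
  (forall n x, `|f_ n x|%:E <= g x)%E ->
  \int[mu]_x f_ n x @[n --> \oo] --> \int[mu]_x f x.
Proof.
move=> mf_ mf cvf ig fg.
have [|||||iF _ cv] := @dominated_convergence _ _ _ mu setT measurableT
  (fun n => EFin \o f_ n) (EFin \o f) g.
- by move=> n; apply/measurable_EFinP.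
- exact/measurable_EFinP.
- by apply: aeW => x _; apply: cvg_EFin; [exact: nearW|exact: cvf].
- exact: ig.
- by apply: aeW => x n _; exact: fg.
apply: fine_cvg; rewrite fineK; last exact: integrable_fin_num.
exact: cv.
Qed.

Unset Implicit Arguments.

Theorem theorem4p5 (R : realType) (X : completeMetricType R)
    (nu : {measure set (borel X) -> \bar R}) (p : R) (q : \bar R)
    (V : @oneform R X -> X -> R) (divV u : X -> R)
    (mu : {charge set (borel X) -> \bar R}) :
  separable_space X ->
  radon nu ->
  doubling nu ->
  weak_poincare11 nu ->
  1 <= p ->
  (p%:E^-1 + q^-1 = 1)%E ->
  has_divergence nu p%:E q V divV ->
  BV nu u ->
  u \in Lfun nu q ->
  anzellotti_measure nu p%:E q V u mu ->
  (\int[nu]_x (u x * divV x)%:E + mu [set: borel X] = 0)%E.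
Proof.
move=> _ _ dbl _ p1 pq Hd [u1 _] uq [P [N [h [_ H]]]].
have [HV Dp _] := Hd.
have [C C0 VC] := tangent_bound HV.
have eta1 n (x : X) : `|cutoff n x| <= (1 : R).
  by rewrite ger0_norm ?cutoff_ge0 ?cutoff_le1.
have dcut n := D11_cutoff dbl n.
have pairing n : charge_integral h (cutoff n) =
    - \int[nu]_x (u x * (V (differential (cutoff n)) x + cutoff n x * divV x)).
  apply: H.
  - exists n.+1%:R^-1 => x y _ _; exact: cutoff_lip.
  - exact: cutoff_compact dbl n.
  - exact: has_divergence_scale p1 pq Hd (dcut n) (eta1 n) (Dnorm_cutoff dbl n).
have iuD : nu.-integrable setT (EFin \o (fun x => u x * divV x)).
  apply: eq_integrable (Lfun_mul_integrable p1 pq Dp uq) => // x _.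
  by rewrite /= mulrC.
have mcut n : measurable_fun [set: borel X] (cutoff n : X -> R).
  exact: D11_measurable (dcut n).
have mu_ := LfunP_measurable u1; have mD := LfunP_measurable Dp.
have Vbound n : {ae nu, forall x, `|V (differential (cutoff n)) x| <= C * n.+1%:R^-1}.
  have := Dnorm_cutoff dbl n; have := VC _ (dcut n).
  apply: ae_imp2 => x Vx Dx; rewrite -lee_fin (le_trans Vx)// EFinM.
  by rewrite lee_wpmul2l.
have iuV n : nu.-integrable setT
    (EFin \o (fun x => u x * V (differential (cutoff n)) x)).
  have pq1 : (1%:E^-1 + (+oo)^-1 = 1 :> \bar R)%E by rewrite invey inve1 adde0.
  apply: (Lfun_mul_integrable (lexx 1) pq1 u1).
  exact: Lfun_infty (tangent_measurable HV (dcut n)) (Vbound n).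
have iucD n : nu.-integrable setT (EFin \o (fun x => u x * (cutoff n x * divV x))).
  apply: (le_integrable measurableT _ _ iuD).
    by apply/measurable_EFinP; apply: measurable_funM => //; exact: measurable_funM.
  move=> x _; rewrite /= lee_fin !normrM ler_wpM2l//.
  by rewrite ler_piMl.
have split n : charge_integral h (cutoff n) =
    (- (\int[nu]_x (u x * V (differential (cutoff n)) x))) -
    (\int[nu]_x (u x * (cutoff n x * divV x))).
  rewrite pairing -opprD; congr (- _); rewrite -RintegralD//.
  by congr fine; apply: eq_integral => x _; rewrite mulrDr.
(* the term with the differentials of the cutoffs is O(1/(n+1)) *)
have cV : \int[nu]_x (u x * V (differential (cutoff n)) x) @[n --> \oo] --> (0 : R).
  pose K := fine (\int[nu]_x `|u x|%:E).
  have iu : nu.-integrable setT (fun x => `|u x|%:E).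
    exact/integrable_norm/Lfun1_integrable.
  have cK : (fun n => C * K * n.+1%:R^-1) @ \oo --> (0 : R).
    rewrite -[X in _ --> X](mulr0 (C * K)); apply: cvgMr; exact: cvg_harmonic.
  apply: (@norm_cvg0 R); apply: (squeeze_cvgr _ (cvg_cst 0) cK).
  apply: nearW => n; rewrite normr_ge0/= -lee_fin.
  apply: (@le_trans _ _ (\int[nu]_x `|u x * V (differential (cutoff n)) x|%:E)%E).
    by apply: norm_Rintegral_le; apply/Lfun1_integrable; exact: iuV.
  apply: (@le_trans _ _ (\int[nu]_x ((C * n.+1%:R^-1)%:E * `|u x|%:E))%E).
    apply: ae_ge0_le_integral => //.
    - by have /integrable_norm/measurable_int := iuV n.
    - by move=> x _; rewrite -EFinM lee_fin !mulr_ge0// invr_ge0.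
    - by apply: measurable_funeM; case/integrableP: iu.
    apply: (ae_imp _ (Vbound n)) => x Vx _.
    by rewrite -EFinM lee_fin normrM mulrC ler_wpM2r.
  have /integrableP[miu _] := iu.
  rewrite ge0_integralZl_EFin ?mulr_ge0 ?invr_ge0//.
  by rewrite -(fineK (integrable_fin_num measurableT iu)) -EFinM lee_fin mulrAC.
have cD : \int[nu]_x (u x * (cutoff n x * divV x)) @[n --> \oo] -->
    \int[nu]_x (u x * divV x).
  apply: (@Rintegral_dominated_cvg _ _ _ nu _ _ (fun x => `|u x * divV x|%:E)).
  - by move=> n; apply: measurable_funM => //; exact: measurable_funM.
  - exact: measurable_funM.
  - move=> x; apply: cvgMr; rewrite -[X in _ --> X]mul1r; apply: cvgMl.
    exact: cutoff_cvg.
  - exact: integrable_norm iuD.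
  - move=> n x; rewrite lee_fin !normrM ler_wpM2l//.
    by rewrite ler_piMl.
(* applied to the positive and negative parts of mu *)
have cJ (m : {finite_measure set (borel X) -> \bar R}) :
    \int[m]_x cutoff n x @[n --> \oo] --> fine (m setT).
  rewrite (_ : fine (m setT) = \int[m]_x (cst 1 : X -> R) x); last first.
    by rewrite Rintegral_cst// mul1r.
  apply: (@Rintegral_dominated_cvg _ _ _ m _ _ (cst 1%E)) => //.
  - exact: cutoff_cvg.
  - exact: finite_measure_integrable_cst.
have cmu : charge_integral h (cutoff n) @[n --> \oo] -->
    fine (jordan_pos h setT) - fine (jordan_neg h setT).
  by apply: cvgB; exact: cJ.
have : charge_integral h (cutoff n) @[n --> \oo] -->
    (- 0) - (\int[nu]_x (u x * divV x)).
  by under eq_fun do rewrite split; apply: cvgB => //; exact: cvgN.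
move=> /(cvg_unique (@norm_hausdorff _ _) cmu) E.
have -> : mu setT = (fine (jordan_pos h setT) - fine (jordan_neg h setT))%:E.
  rewrite EFinB !fineK ?fin_num_measure//.
  by rewrite (jordan_decomp h measurableT) /cadd/= cscaleN1.
rewrite E -(fineK (integrable_fin_num measurableT iuD)) -EFinD; congr _%:E.
by rewrite oppr0 sub0r /Rintegral subrr.
Qed.
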